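(* Let $R$ be a right noetherian ring with $\mathrm{findim}(R_R)<\infty$. Let $(\mathcal A,\mathcal B)$ be the cotorsion pair in $\mathrm{Mod}\,R$ generated by $\mathcal P^{<\infty}$, and let $\omega=\mathcal A\cap\mathcal B$ be its kernel. Then: (a) $\mathrm{Findim}(R_R)-\mathrm{findim}(R_R)\le \mathrm{resdim}_{\mathcal A}(\mathcal P)$. (b) $\mathrm{Findim}(R_R)=\mathrm{findim}(R_R)$ if and only if $\mathrm{pd}\,\omega^\wedge=\mathrm{pd}\,\omega$.
   Context: $R$ is an associative ring with unit. $\mathrm{Mod}\,R$ is the category of all right $R$-modules; $\mathrm{mod}\,R$ is the full subcategory of modules possessing a projective resolution consisting of finitely generated projective modules. $\mathcal P$ is the class of all $M\in\mathrm{Mod}\,R$ with finite projective dimension, and $\mathcal P^{<\infty}=\mathcal P\cap\mathrm{mod}\,R$. For a class $\mathcal Y$ of modules, $\mathrm{pd}\,\mathcal Y=\sup\{\mathrm{pd}\,Y:Y\in\mathcal Y\}$. $\mathrm{Findim}(R_R)=\mathrm{pd}\,\mathcal P$ and $\mathrm{findim}(R_R)=\mathrm{pd}\,\mathcal P^{<\infty}$ (values in $\{0,1,\dots\}\cup\{\infty\}$). The cotorsion pair generated by a class $\mathcal X$ is $(\mathcal A,\mathcal B)$ with $\mathcal B=\{M:\mathrm{Ext}^1_R(X,M)=0\ \forall X\in\mathcal X\}$ and $\mathcal A=\{M:\mathrm{Ext}^1_R(M,B)=0\ \forall B\in\mathcal B\}$. For a class $\mathcal X$ and a module $M$, $\mathrm{resdim}_{\mathcal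 X}(M)$ is the least $n\ge 0$ such that there is an exact sequence $0\to X_n\to\cdots\to X_1\to X_0\to M\to 0$ with all $X_i\in\mathcal X$ ($\infty$ if there is none); $\mathrm{resdim}_{\mathcal X}(\mathcal Y)=\sup\{\mathrm{resdim}_{\mathcal X}(Y):Y\in\mathcal Y\}$; and $\mathcal X^\wedge=\{M:\mathrm{resdim}_{\mathcal X}(M)<\infty\}$. *)

(* Defs.v *)
From HB Require Import structures.
From mathcomp Require Import all_boot all_order all_algebra.
From mathcomp Require Import boolp classical_sets reals ereal Rstruct.

Set Implicit Arguments.
Unset Strict Implicit.
Unset Printing Implicit Defensive.

Import Order.TTheory GRing.Theory Num.Theory.
Local Open Scope ring_scope.

(* A right R-module is a left module over the opposite ring R^c: the action
   is r, x |-> r *: x, with (r * s : R) *: x = s *: (r *: x). *)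
Notation rmodType R := (lmodType R^c).

(* Classes are bare predicates rather than [set (rmodType R)], so that no
   universe constraint arises between modules and [classical_sets.set]. *)
Definition mod_class (R : pzRingType) := rmodType R -> Prop.

Section Ring.
Variable R : pzRingType.

Definition is_right_ideal (I : set R) : Prop :=
  [/\ I 0, forall x y, I x -> I y -> I (x + y)
    & forall x r, I x -> I (x * r)].

Definition right_noetherian : Prop :=
  forall I : nat -> set R,
    (forall n, is_right_ideal (I n)) ->
    (forall n x, I n x -> I n.+1 x) ->
    exists N, forall n, (N <= n)%N -> I n = I N.

Implicit Types (X Y : mod_class R) (M A C : rmodType R).

Definition fin_gen M : Prop :=
  exists (n : nat) (v : 'I_n -> M),
    forall x, exists c : 'I_n -> R^c, x = \sum_(i < n) c i *: v i.

Definition projective M : Prop :=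
  forall (U V : rmodType R) (g : {linear U -> V}) (f : {linear M -> V}),
    (forall v, exists u, g u = v) ->
    exists h : {linear M -> U}, forall x, g (h x) = f x.

(* Exact sequences ... -> X_2 -> X_1 -> X_0 -> M -> 0. *)
Record resolution M := Resolution {
  res_obj : nat -> rmodType R;
  res_diff : forall i, {linear res_obj i.+1 -> res_obj i};
  res_aug : {linear res_obj 0 -> M};
  res_aug_surj : forall m, exists x, res_aug x = m;
  res_exact0 : forall x, res_aug x = 0 <-> exists y, res_diff 0 y = x;
  res_exact : forall i x,
    res_diff i x = 0 <-> exists y, res_diff i.+1 y = x
}.

(* Finite exact sequences 0 -> X_n -> ... -> X_0 -> M -> 0 are resolutions
   padded with zero modules above degree n. *)
Definition has_resolution X M (n : nat) : Prop :=
  exists r : resolution M,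
    (forall i, (i <= n)%N -> X (res_obj r i)) /\
    (forall i, (n < i)%N -> forall x : res_obj r i, x = 0).

(* Dimensions live in the extended reals, so that infima (+oo on the empty
   set), suprema and differences are those of the library. The supremum of the
   empty set is -oo there, but all classes considered below contain the zero
   module. *)
Definition resdim X M : \bar Rdefinitions.R :=
  ereal_inf [set e | exists2 n : nat, has_resolution X M n & e = (n%:R)%:E].

Definition resdim_class X Y : \bar Rdefinitions.R :=
  ereal_sup [set e | exists2 M, Y M & e = resdim X M].

Definition wedge X : mod_class R := fun M => (resdim X M < +oo)%E.

Definition pd M : \bar Rdefinitions.R := resdim projective M.

Definition pd_class Y : \bar Rdefinitions.R :=
  ereal_sup [set e | exists2 M, Y M & e = pd M].

Definition small_mod : mod_class R := fun M =>
  exists r : resolution M,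
    forall i, projective (res_obj r i) /\ fin_gen (res_obj r i).

Definition finite_pd : mod_class R := fun M => (pd M < +oo)%E.

Definition small_finite_pd : mod_class R := fun M => finite_pd M /\ small_mod M.

Definition Findim : \bar Rdefinitions.R := pd_class finite_pd.
Definition findim : \bar Rdefinitions.R := pd_class small_finite_pd.

(* Yoneda description of Ext^1(C, A): extensions 0 -> A -> E -> C -> 0 up to
   equivalence, the class of the split extension being zero. *)
Record extension C A := Extension {
  ext_mid : rmodType R;
  ext_in : {linear A -> ext_mid};
  ext_out : {linear ext_mid -> C};
  ext_in_inj : injective ext_in;
  ext_out_surj : forall c, exists e, ext_out e = c;
  ext_exact : forall e, ext_out e = 0 <-> exists a, ext_in a = e
}.

Definition ext_equiv C A (e1 e2 : extension C A) : Prop :=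
  exists phi : {linear ext_mid e1 -> ext_mid e2},
    [/\ bijective phi, forall a, phi (ext_in e1 a) = ext_in e2 a
      & forall x, ext_out e2 (phi x) = ext_out e1 x].

Section Split.
Variables C A : rmodType R.

Definition split_in (a : A) : (A * C)%type := (a, 0).
Definition split_out (x : (A * C)%type) : C := x.2.

Fact split_in_linear : linear split_in.
Proof. by move=> r a b; rewrite /split_in; congr pair; rewrite /= scaler0 addr0. Qed.
HB.instance Definition _ :=
  GRing.isLinear.Build R^c A (A * C)%type *:%R split_in split_in_linear.

Fact split_out_linear : linear split_out.
Proof. by []. Qed.
HB.instance Definition _ :=
  GRing.isLinear.Build R^c (A * C)%type C *:%R split_out split_out_linear.

Fact split_in_inj : injective split_in.
Proof. by move=> a b []. Qed.

Fact split_out_surj c : exists x, split_out x = c.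
Proof. by exists (0, c). Qed.

Fact split_exact x : split_out x = 0 <-> exists a, split_in a = x.
Proof.
by case: x => a c; split=> [/= -> | [b [_ <-]]] //; exists a.
Qed.

Definition split_extension : extension C A :=
  Extension split_in_inj split_out_surj split_exact.

End Split.

Definition Ext1_zero C A : Prop :=
  forall e : extension C A, ext_equiv e (split_extension C A).

(* The cotorsion pair (cot_left X, cot_right X) generated by X. *)
Definition cot_right X : mod_class R := fun M =>
  forall C, X C -> Ext1_zero C M.
Definition cot_left X : mod_class R := fun M =>
  forall B, cot_right X B -> Ext1_zero M B.
Definition cot_kernel X : mod_class R := fun M => cot_left X M /\ cot_right X M.

End Ring.

Arguments small_mod {R} M.
Arguments finite_pd {R} M.
Arguments small_finite_pd {R} M.
Arguments projective {R} M.

(* Main.v *)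
From HB Require Import structures.
Require Import Defs.
From mathcomp Require Import all_boot all_order all_algebra.
From mathcomp Require Import boolp classical_sets reals ereal Rstruct.

(* Let n = findim. Every n-th cosyzygy lies in B, by dimension shifting, so every
   module in A has projective dimension at most n; this gives (a).

   For (b), B-preenvelopes with cokernel in A show pd omega = n: if M in A has
   pd M = n > 0 and 0 -> M -> W -> A' -> 0 with W in omega and A' in A, then
   pd W < n would force pd A' = n + 1. Conversely, let M have finite projective
   dimension and 0 -> M -> W -> A' -> 0 with W in B and A' in A. Then W has finite
   projective dimension, and iterating A-precovers with kernels in B gives a
   finite omega-resolution of W. So pd W <= n if pd omega^wedge = n, and then
   pd M <= n since pd A' <= n.

   The kernel terms of presentations of modules in P^{<oo} are finitely
   generated, so countably many steps of the small object argument yield the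
   preenvelopes. The same argument applied to the right ideals of the noetherian
   ring, with Baer's criterion, yields enough injectives. *)

Set Implicit Arguments.
Unset Strict Implicit.
Unset Printing Implicit Defensive.

Import Order.TTheory GRing.Theory Num.Theory.
Local Open Scope ring_scope.

(** * Linear maps, submodules, quotients and products *)

Section LinearMaps.
Variable S : pzRingType.
Implicit Types U V W : lmodType S.

Definition lin U V (f : U -> V) (lf : linear f) : {linear U -> V} :=
  HB.pack f (GRing.isLinear.Build _ _ _ _ f lf).

Arguments lin : simpl never.

Lemma linE U V (f : U -> V) (lf : linear f) x : lin lf x = f x.
Proof. by []. Qed.

Lemma idl_linear U : linear (fun x : U => x).
Proof. by []. Qed.
Definition idl U := lin (@idl_linear U).

Lemma complin_linear U V W (g : {linear V -> W}) (f : {linear U -> V}) :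
  linear (fun x => g (f x)).
Proof. by move=> a x y; rewrite !linearP. Qed.
Definition complin U V W (g : {linear V -> W}) (f : {linear U -> V}) :=
  lin (complin_linear g f).
Lemma complinE U V W (g : {linear V -> W}) (f : {linear U -> V}) x :
  complin g f x = g (f x).
Proof. by []. Qed.

Lemma zerol_linear U V : linear (fun _ : U => 0 : V).
Proof. by move=> a x y; rewrite scaler0 addr0. Qed.
Definition zerol U V := lin (@zerol_linear U V).

Lemma subl_linear U V (f g : {linear U -> V}) : linear (fun x => f x - g x).
Proof.
by move=> a x y; rewrite (linearP f) (linearP g) scalerBr opprD addrACA.
Qed.
Definition subl U V (f g : {linear U -> V}) := lin (subl_linear f g).
Lemma sublE U V (f g : {linear U -> V}) x : subl f g x = f x - g x.
Proof. by []. Qed.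

End LinearMaps.

Arguments lin : simpl never.

Section Submodules.
Variable S : pzRingType.
Implicit Types M N : lmodType S.

(** Submodules are Prop-valued predicates, so kernels, images and annihilator-like ideals can be
    written as bare propositions; [sm_mem] makes them boolean classically. *)
Record submodule M := Submodule {
  sm_pred :> M -> Prop;
  sm0 : sm_pred 0;
  smP : forall a x y, sm_pred x -> sm_pred y -> sm_pred (a *: x + y) }.

Lemma smD M (K : submodule M) x y : K x -> K y -> K (x + y).
Proof. by move=> Kx Ky; rewrite -[x]scale1r; apply: smP. Qed.

Lemma smZ M (K : submodule M) a x : K x -> K (a *: x).
Proof. by move=> Kx; rewrite -[_ *: _]addr0; apply: smP => //; apply: sm0. Qed.

Lemma smN M (K : submodule M) x : K x -> K (- x).
Proof. by move=> Kx; rewrite -scaleN1r; apply: smZ. Qed.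

Lemma smB M (K : submodule M) x y : K x -> K y -> K (x - y).
Proof. by move=> Kx Ky; apply: smD => //; apply: smN. Qed.

Section Sub.
Variables (M : lmodType S) (K : submodule M).

Definition sm_mem : {pred M} := fun x => `[<K x>].

Fact sm_mem_closed : submod_closed sm_mem.
Proof.
split; first by apply/asboolP/sm0.
by move=> a x y /asboolP Kx /asboolP Ky; apply/asboolP/smP.
Qed.
HB.instance Definition _ := GRing.isSubmodClosed.Build S M sm_mem sm_mem_closed.

Definition subm_type := {x : M | x \in sm_mem}.
HB.instance Definition _ := SubChoice.on subm_type.
HB.instance Definition _ := [SubChoice_isSubLmodule of subm_type by <:].
Definition subm : lmodType S := subm_type.

Fact subm_val_linear : linear (fun x : subm => val (x : subm_type)).
Proof. by []. Qed.
Definition subm_val : {linear subm -> M} := lin subm_val_linear.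

Lemma subm_inj : injective subm_val.
Proof. exact: val_inj. Qed.

Lemma subm_valP x : K (subm_val x).
Proof. by apply/asboolP; case: x. Qed.

Lemma subm_exP x : K x -> exists y : subm, subm_val y = x.
Proof. by move=> /asboolP Kx; exists (exist _ x Kx). Qed.

Section Factor.
Variables (N : lmodType S) (f : {linear N -> M}) (Kf : forall x, K (f x)).

Definition subm_fac_fun x : subm :=
  exist _ (f x) (asboolT (Kf x) : f x \in sm_mem).

Fact subm_fac_linear : linear subm_fac_fun.
Proof. by move=> a x y; apply: val_inj; rewrite /= linearP. Qed.
Definition subm_fac : {linear N -> subm} := lin subm_fac_linear.

Lemma subm_facE x : subm_val (subm_fac x) = f x.
Proof. by []. Qed.

End Factor.

End Sub.

Section Quotient.
Variables (M : lmodType S) (K : submodule M).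

Definition qclass (x : M) : pred M := fun y => `[<K (x - y)>].

Fact qclass_ex x : exists y, qclass x y.
Proof. by exists x; apply/asboolP; rewrite subrr; apply: sm0. Qed.

Definition qrepr (x : M) : M := xchoose (qclass_ex x).

Lemma qreprP x : K (x - qrepr x).
Proof. by apply/asboolP; exact: xchooseP (qclass_ex x). Qed.

(** The predicates [qclass x] and [qclass y] describe the same coset, and [xchoose] depends only on
    the values of its predicate. *)
Lemma qrepr_eq x y : K (x - y) -> qrepr x = qrepr y.
Proof.
move=> Kxy; apply: eq_xchoose => z.
apply: asbool_equiv_eq; split => Kz.
  by have := smB Kz Kxy; rewrite opprB addrC addrA subrK.
by have := smD Kxy Kz; rewrite addrA subrK.
Qed.

Lemma qreprK x : qrepr (qrepr x) = qrepr x.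
Proof. by apply/esym/qrepr_eq/qreprP. Qed.

(* The cosets are encoded by their chosen representatives. *)
Definition quotm_type := {x : M | qrepr x == x}.
HB.instance Definition _ := SubChoice.on quotm_type.

Definition qpi (x : M) : quotm_type :=
  exist _ (qrepr x) (introT eqP (qreprK x)).

Lemma qpi_eq x y : K (x - y) -> qpi x = qpi y.
Proof. by move=> Kxy; apply: val_inj; apply: qrepr_eq. Qed.

Lemma qpi_val (z : quotm_type) : qpi (val z) = z.
Proof. by apply: val_inj; case: z => x /= /eqP. Qed.

Lemma val_qpi x : K (x - val (qpi x)).
Proof. exact: qreprP. Qed.

Let addq (x y : quotm_type) := qpi (val x + val y).
Let oppq (x : quotm_type) := qpi (- val x).
Let scaleq a (x : quotm_type) := qpi (a *: val x).

Lemma qpiD x y : qpi (x + y) = addq (qpi x) (qpi y).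
Proof. by apply: qpi_eq; rewrite opprD addrACA; apply: smD; apply: val_qpi. Qed.
Lemma qpiN x : qpi (- x) = oppq (qpi x).
Proof. by apply: qpi_eq; rewrite -opprD; apply: smN; apply: val_qpi. Qed.
Lemma qpiZ a x : qpi (a *: x) = scaleq a (qpi x).
Proof. by apply: qpi_eq; rewrite -scalerBr; apply: smZ; apply: val_qpi. Qed.

Fact addqA : associative addq.
Proof.
move=> x y z; rewrite -(qpi_val x) -(qpi_val y) -(qpi_val z).
by rewrite -!qpiD addrA.
Qed.
Fact addqC : commutative addq.
Proof. by move=> x y; rewrite /addq addrC. Qed.
Fact add0q : left_id (qpi 0) addq.
Proof. by move=> x; rewrite -(qpi_val x) -qpiD add0r. Qed.
Fact addNq : left_inverse (qpi 0) oppq addq.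
Proof. by move=> x; rewrite -(qpi_val x) -qpiN -qpiD addNr. Qed.
HB.instance Definition _ := GRing.isZmodule.Build quotm_type addqA addqC add0q addNq.

Fact scaleqA a b x : scaleq a (scaleq b x) = scaleq (a * b) x.
Proof. by rewrite -(qpi_val x) -!qpiZ scalerA. Qed.
Fact scale1q : left_id 1 scaleq.
Proof. by move=> x; rewrite -(qpi_val x) -!qpiZ scale1r. Qed.
Fact scaleqDr : right_distributive scaleq +%R.
Proof.
move=> a x y; rewrite -(qpi_val x) -(qpi_val y).
by rewrite -[LHS]/(scaleq a (addq _ _)) -qpiD -qpiZ scalerDr qpiD !qpiZ.
Qed.
Fact scaleqDl x : {morph scaleq^~ x : a b / a + b}.
Proof. by move=> a b; rewrite -(qpi_val x) -!qpiZ scalerDl qpiD. Qed.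
HB.instance Definition _ := GRing.Zmodule_isLmodule.Build S quotm_type
  scaleqA scale1q scaleqDr scaleqDl.
Definition quotm : lmodType S := quotm_type.

Fact quot_pi_linear : linear (qpi : M -> quotm).
Proof. by move=> a x y; rewrite qpiD qpiZ. Qed.
Definition quot_pi : {linear M -> quotm} := lin quot_pi_linear.

Lemma quot_pi_surj z : exists x, quot_pi x = z.
Proof. by exists (val z); exact: qpi_val. Qed.

Lemma quot_pi0 x : quot_pi x = 0 <-> K x.
Proof.
split=> [/(congr1 val) x0|Kx]; last by apply: qpi_eq; rewrite subr0.
(* The zero of the quotient is represented by [qrepr 0], which lies in [K] but need not be 0. *)
have K0 := qreprP 0; rewrite sub0r in K0.
have := qreprP x; rewrite -[qrepr x]/(val (quot_pi x)) x0 => Kx.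
by have := smB Kx K0; rewrite opprK subrK.
Qed.

Lemma quot_lift (N : lmodType S) (f : {linear M -> N}) :
  (forall x, K x -> f x = 0) ->
  exists g : {linear quotm -> N}, forall x, g (quot_pi x) = f x.
Proof.
move=> f0; have fq x : f (val (qpi x)) = f x.
  by apply/esym/eqP; rewrite -subr_eq0 -(linearB f) f0 //; apply: val_qpi.
have lg : linear (fun z : quotm => f (val (z : quotm_type))).
  move=> a x y; rewrite -(linearP f) -(fq (_ + _)).
  by congr (f (val _)); rewrite qpiD qpiZ !qpi_val.
by exists (lin lg) => x; exact: fq.
Qed.

End Quotient.

Section Product.
Variables (X : Type) (M : X -> lmodType S).

Definition prodm_type := forall x, M x.
HB.instance Definition _ := gen_eqMixin prodm_type.
HB.instance Definition _ := gen_choiceMixin prodm_type.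

Let zerop : prodm_type := fun=> 0.
Let addp (f g : prodm_type) : prodm_type := fun x => f x + g x.
Let oppp (f : prodm_type) : prodm_type := fun x => - f x.
Let scalep a (f : prodm_type) : prodm_type := fun x => a *: f x.

Fact addpA : associative addp.
Proof. by move=> f g h; apply: functional_extensionality_dep => x; exact: addrA. Qed.
Fact addpC : commutative addp.
Proof. by move=> f g; apply: functional_extensionality_dep => x; exact: addrC. Qed.
Fact add0p : left_id zerop addp.
Proof. by move=> f; apply: functional_extensionality_dep => x; exact: add0r. Qed.
Fact addNp : left_inverse zerop oppp addp.
Proof. by move=> f; apply: functional_extensionality_dep => x; exact: addNr. Qed.
HB.instance Definition _ := GRing.isZmodule.Build prodm_type addpA addpC add0p addNp.

Fact scalepA a b f : scalep a (scalep b f) = scalep (a * b) f.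
Proof. by apply: functional_extensionality_dep => x; exact: scalerA. Qed.
Fact scale1p : left_id 1 scalep.
Proof. by move=> f; apply: functional_extensionality_dep => x; exact: scale1r. Qed.
Fact scalepDr : right_distributive scalep +%R.
Proof. by move=> a f g; apply: functional_extensionality_dep => x; exact: scalerDr. Qed.
Fact scalepDl f : {morph scalep^~ f : a b / a + b}.
Proof. by move=> a b; apply: functional_extensionality_dep => x; exact: scalerDl. Qed.
HB.instance Definition _ := GRing.Zmodule_isLmodule.Build S prodm_type
  scalepA scale1p scalepDr scalepDl.
Definition prodm : lmodType S := prodm_type.

Lemma prodmP (f g : prodm) : (forall x, f x = g x) -> f = g.
Proof. exact: functional_extensionality_dep. Qed.

End Product.
End Submodules.

Arguments subm_val {S M K}.
Arguments subm_inj {S M K}.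
Arguments subm_valP {S M K}.
Arguments quot_pi_surj {S M K}.

(** * Direct sums, pushouts and sequential colimits *)

Section DirectSum.
Variables (S : pzRingType) (X : eqType) (M : X -> lmodType S).

Definition supported (f : prodm M) (l : seq X) :=
  forall x, x \notin l -> f x = 0.

Fact dsum_smP a (f g : prodm M) :
  (exists l, supported f l) -> (exists l, supported g l) ->
  exists l, supported (a *: f + g) l.
Proof.
move=> [l fl] [m gm]; exists (l ++ m) => x.
rewrite mem_cat negb_or => /andP[xl xm].
by rewrite -[LHS]/(a *: f x + g x) fl // gm // scaler0 addr0.
Qed.

Definition dsum_sub := Submodule (ex_intro _ [::] (fun=> fun=> erefl) :
  exists l, supported 0 l) dsum_smP.

Definition dsum : lmodType S := subm dsum_sub.

Fact dsum_at_linear x : linear (fun f : dsum => (subm_val f : prodm M) x).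
Proof. by []. Qed.
Definition dsum_at x : {linear dsum -> M x} := lin (dsum_at_linear x).

Lemma dsumP (f g : dsum) : (forall x, dsum_at x f = dsum_at x g) -> f = g.
Proof. by move=> fg; apply: subm_inj; apply: prodmP. Qed.

Section Injection.
Variable x0 : X.

(** The summands depend on the index, so [m] is transported along the equality test; at [x0] the
    transport is the identity since the indices form an [eqType]. *)
Definition single (m : M x0) : prodm M := fun x =>
  if x0 =P x is ReflectT e then eq_rect x0 M m x e else 0.

Lemma single_eq m : single m x0 = m.
Proof. by rewrite /single; case: eqP => // e; rewrite eq_axiomK. Qed.

Lemma single_neq m x : x0 != x -> single m x = 0.
Proof. by rewrite /single; case: eqP. Qed.

Fact single_linear : linear single.
Proof.
move=> a m n; apply: prodmP => x; rewrite -[RHS]/(a *: single m x + single n x).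
have [<-|x0x] := eqVneq x0 x; first by rewrite !single_eq.
by rewrite !single_neq // scaler0 addr0.
Qed.

Fact single_dsum m : dsum_sub (lin single_linear m).
Proof.
by exists [:: x0] => x; rewrite inE eq_sym => x0x; exact: single_neq.
Qed.

Definition dsum_in : {linear M x0 -> dsum} := subm_fac single_dsum.

Lemma dsum_at_in m : dsum_at x0 (dsum_in m) = m.
Proof. exact: single_eq. Qed.

Lemma dsum_at_in_neq m x : x0 != x -> dsum_at x (dsum_in m) = 0.
Proof. exact: single_neq. Qed.

End Injection.

Definition dsupp (f : dsum) : seq X := undup (projT1 (cid (subm_valP f))).

Lemma dsuppP f x : x \notin dsupp f -> dsum_at x f = 0.
Proof. by rewrite mem_undup; exact: projT2 (cid (subm_valP f)) x. Qed.

Lemma dsum_big_supp (Y : nmodType) (F : X -> Y) (l m : seq X) : uniq l -> uniq m ->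
  {subset l <= m} -> (forall x, x \notin l -> F x = 0) ->
  \sum_(x <- m) F x = \sum_(x <- l) F x.
Proof.
move=> ul um lm F0; rewrite (bigID (mem l)) /= [X in _ + X]big1 ?addr0; last first.
  by move=> x; exact: F0.
rewrite -big_filter; apply: perm_big; apply: uniq_perm => //.
  by rewrite filter_uniq.
by move=> x; rewrite mem_filter; apply: andb_idr; exact: lm.
Qed.

Section Lift.
Variables (Y : lmodType S) (h : forall x, {linear M x -> Y}).

Definition dsum_lift_fun (f : dsum) : Y := \sum_(x <- dsupp f) h x (dsum_at x f).

(** Terms outside the chosen support vanish, so any larger list gives the same sum. Additivity
    follows by summing over one list that covers the supports chosen for [f], [g] and their
    combination. *)
Lemma dsum_lift_funE (f : dsum) l : uniq l -> {subset dsupp f <= l} ->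
  dsum_lift_fun f = \sum_(x <- l) h x (dsum_at x f).
Proof.
move=> ul fl; apply/esym/dsum_big_supp => //; first exact: undup_uniq.
by move=> x /dsuppP ->; rewrite linear0.
Qed.

Fact dsum_lift_linear : linear dsum_lift_fun.
Proof.
move=> a f g; set l := undup (dsupp f ++ dsupp g ++ dsupp (a *: f + g)).
have ul : uniq l by apply: undup_uniq.
rewrite !(@dsum_lift_funE _ l) // => [|x xf|x xf|x xf]; last first.
- by rewrite mem_undup !mem_cat xf !orbT.
- by rewrite mem_undup !mem_cat xf.
- by rewrite mem_undup !mem_cat xf !orbT.
rewrite scaler_sumr -big_split; apply: eq_bigr => x _ /=.
by rewrite linearP.
Qed.
Definition dsum_lift : {linear dsum -> Y} := lin dsum_lift_linear.

Lemma dsum_lift_in x m : dsum_lift (dsum_in x m) = h x m.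
Proof.
rewrite -[LHS]/(dsum_lift_fun _).
rewrite (@dsum_lift_funE _ (undup (x :: dsupp (dsum_in x m)))) ?undup_uniq //.
  rewrite (@dsum_big_supp _ _ [:: x]) ?undup_uniq //.
  - by rewrite big_seq1 (dsum_at_in m).
  - by move=> y; rewrite inE => /eqP ->; rewrite mem_undup mem_head.
  - by move=> y; rewrite inE eq_sym => xy; rewrite dsum_at_in_neq ?linear0.
by move=> y yf; rewrite mem_undup inE yf orbT.
Qed.

End Lift.

Lemma dsum_sum_in (f : dsum) : f = \sum_(x <- dsupp f) dsum_in x (dsum_at x f).
Proof.
apply: dsumP => x; rewrite linear_sum.
have [xf|xf] := boolP (x \in dsupp f).
  rewrite (bigD1_seq x) ?undup_uniq // big1 => [|y yx].
    by rewrite (dsum_at_in (dsum_at x f)); apply/esym/addr0.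
  exact: dsum_at_in_neq.
rewrite dsuppP // big_seq big1 // => y yf; apply: dsum_at_in_neq.
by apply: contraNneq xf => <-.
Qed.

Lemma dsum_hom_ext (Y : lmodType S) (f g : {linear dsum -> Y}) :
  (forall x m, f (dsum_in x m) = g (dsum_in x m)) -> forall z, f z = g z.
Proof.
move=> fg z; rewrite (dsum_sum_in z) !linear_sum.
by apply: eq_bigr => x _; exact: fg.
Qed.

End DirectSum.

Section DirectSumMap.
Variables (S : pzRingType) (X : eqType) (U V : X -> lmodType S).
Variable i : forall x, {linear U x -> V x}.

Definition dsum_map : {linear dsum U -> dsum V} :=
  dsum_lift (fun x => complin (dsum_in V x) (i x)).

Lemma dsum_map_in x u : dsum_map (dsum_in U x u) = dsum_in V x (i x u).
Proof. exact: dsum_lift_in. Qed.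

Lemma dsum_at_map x f : dsum_at V x (dsum_map f) = i x (dsum_at U x f).
Proof.
pose at_map := complin (dsum_at V x) dsum_map.
pose map_at := complin (i x) (dsum_at U x).
suff : forall z, at_map z = map_at z by apply.
apply: dsum_hom_ext => y u.
rewrite /at_map /map_at !complinE dsum_map_in.
have [<-|yx] := eqVneq y x; first by rewrite !dsum_at_in.
by rewrite !dsum_at_in_neq ?linear0.
Qed.

Lemma dsum_map_inj : (forall x, injective (i x)) -> injective dsum_map.
Proof.
move=> i_inj f g fg; apply: dsumP => x; apply: (i_inj x).
by rewrite -!dsum_at_map fg.
Qed.

End DirectSumMap.

Section Pushout.
Variables (S : pzRingType) (K B X : lmodType S).
Variables (i : {linear K -> B}) (h : {linear K -> X}).

Fact po_sm0 : exists k, (0 : B * X) = (i k, - h k).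
Proof. by exists 0; rewrite !linear0. Qed.
Fact po_smP a (x y : B * X) : (exists k, x = (i k, - h k)) ->
  (exists k, y = (i k, - h k)) -> exists k, a *: x + y = (i k, - h k).
Proof.
move=> [k ->] [l ->]; exists (a *: k + l).
by rewrite (linearP i) (linearP h) opprD -scalerN.
Qed.

Definition po : lmodType S := quotm (Submodule po_sm0 po_smP).

Fact po_inl_linear : linear (fun b : B => quot_pi (Submodule po_sm0 po_smP) (b, 0)).
Proof.
by move=> a b c; rewrite -linearP; congr (quot_pi _ (_, _)); rewrite /= scaler0 addr0.
Qed.
Definition po_inl : {linear B -> po} := lin po_inl_linear.

Fact po_inr_linear : linear (fun x : X => quot_pi (Submodule po_sm0 po_smP) (0, x)).
Proof.
by move=> a b c; rewrite -linearP; congr (quot_pi _ (_, _)); rewrite /= scaler0 addr0.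
Qed.
Definition po_inr : {linear X -> po} := lin po_inr_linear.

Lemma po_eq0 b x : po_inl b + po_inr x = 0 <-> exists k, b = i k /\ x = - h k.
Proof.
rewrite -[_ + _](linearD (quot_pi _)) quot_pi0.
rewrite (_ : (b, 0) + (0, x) = (b, x)); last by congr pair; rewrite ?addr0 ?add0r.
by split=> -[k]; [case=> -> ->; exists k | move=> [-> ->]; exists k].
Qed.

Lemma po_comm k : po_inl (i k) = po_inr (h k).
Proof.
apply/eqP; rewrite -subr_eq0 -(linearN po_inr); apply/eqP/po_eq0.
by exists k.
Qed.

Lemma po_ex z : exists b x, z = po_inl b + po_inr x.
Proof.
have [[b x] <-] := quot_pi_surj z; exists b, x.
by rewrite -[RHS](linearD (quot_pi _)); congr (quot_pi _ (_, _)); rewrite ?addr0 ?add0r.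
Qed.

Lemma po_lift (Y : lmodType S) (f : {linear B -> Y}) (g : {linear X -> Y}) :
  (forall k, f (i k) = g (h k)) ->
  exists t : {linear po -> Y},
    (forall b, t (po_inl b) = f b) /\ (forall x, t (po_inr x) = g x).
Proof.
move=> fg; have lt : linear (fun z : B * X => f z.1 + g z.2).
  by move=> a y z; rewrite (linearP f) (linearP g) scalerDr addrACA.
have [|t tE] := @quot_lift _ _ (Submodule po_sm0 po_smP) _ (lin lt).
  by move=> _ [k ->]; rewrite linE /= linearN fg subrr.
by exists t; split=> [b|x]; rewrite tE linE /= linear0 ?addr0 ?add0r.
Qed.

End Pushout.

Section Colimit.
Variables (S : pzRingType) (N : nat -> lmodType S).
Variable step : forall i, {linear N i -> N i.+1}.

(* The transition map from stage i to stage j, and zero when j < i. *)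
Fixpoint trans i j : {linear N i -> N j} :=
  if i =P j is ReflectT e
  then eq_rect i (fun j => {linear N i -> N j}) (idl (N i)) j e
  else match j with
       | 0 => zerol (N i) (N 0)
       | j'.+1 => complin (step j') (trans i j')
       end.

Lemma trans_id i x : trans i i x = x.
Proof. by case: i x => [|i] x /=; case: eqP => // e; rewrite eq_axiomK. Qed.

Lemma transS i j x : (i <= j)%N -> trans i j.+1 x = step j (trans i j x).
Proof. by move=> ij /=; case: eqP => // e; rewrite e ltnn in ij. Qed.

Lemma trans_trans i j k x : (i <= j)%N -> (j <= k)%N ->
  trans j k (trans i j x) = trans i k x.
Proof.
move=> ij; elim: k => [|k IHk].
  by rewrite leqn0 => /eqP j0; subst j; rewrite trans_id.
rewrite leq_eqVlt => /predU1P[<-|]; first by rewrite trans_id.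
by rewrite ltnS => jk; rewrite !transS ?IHk ?(leq_trans ij).
Qed.

Fact evz_smP a (f g : prodm N) :
  (exists k, forall j, (k <= j)%N -> f j = 0) ->
  (exists k, forall j, (k <= j)%N -> g j = 0) ->
  exists k, forall j, (k <= j)%N -> (a *: f + g) j = 0.
Proof.
move=> [k f0] [l g0]; exists (maxn k l) => j; rewrite geq_max => /andP[kj lj].
by rewrite -[LHS]/(a *: f j + g j) f0 // g0 // scaler0 addr0.
Qed.

(** The colimit is realised inside the product of the stages modulo eventually zero families: an
    element of a stage is sent to the sequence of its later images. *)
Definition evz := Submodule (ex_intro _ 0 (fun=> fun=> erefl) :
  exists k, forall j, (k <= j)%N -> (0 : prodm N) j = 0) evz_smP.

Fact thread_linear i : linear (fun x => (fun j => trans i j x) : prodm N).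
Proof. by move=> a x y; apply: prodmP => j; rewrite linearP. Qed.

Definition thread i : {linear N i -> quotm evz} :=
  complin (quot_pi evz) (lin (@thread_linear i)).

Lemma thread_trans i j x : (i <= j)%N -> thread j (trans i j x) = thread i x.
Proof.
move=> ij; apply/eqP; rewrite -subr_eq0 -(linearB (quot_pi evz)).
apply/eqP/quot_pi0; exists j => k jk.
by rewrite -[LHS]/(trans j k (trans i j x) - trans i k x) trans_trans ?subrr.
Qed.

Fact colim_sm0 : exists i x, 0 = thread i x.
Proof. by exists 0, 0; rewrite linear0. Qed.
Fact colim_smP a y z : (exists i x, y = thread i x) ->
  (exists i x, z = thread i x) -> exists i x, a *: y + z = thread i x.
Proof.
move=> [i [x ->]] [j [w ->]]; exists (maxn i j).
exists (a *: trans i (maxn i j) x + trans j (maxn i j) w).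
by rewrite linearP !thread_trans ?leq_maxl ?leq_maxr.
Qed.

Definition colim_sub := Submodule colim_sm0 colim_smP.
Definition colim : lmodType S := subm colim_sub.

Fact thread_colim i x : colim_sub (thread i x).
Proof. by exists i, x. Qed.
Definition colim_in i : {linear N i -> colim} := subm_fac (@thread_colim i).

Lemma colim_trans i j x : (i <= j)%N -> colim_in j (trans i j x) = colim_in i x.
Proof. by move=> ij; apply: subm_inj; exact: thread_trans. Qed.

Lemma colim_step i x : colim_in i.+1 (step i x) = colim_in i x.
Proof. by rewrite -[in RHS](@colim_trans i i.+1) // transS // trans_id. Qed.

Lemma colim_ex z : exists i x, z = colim_in i x.
Proof.
by have [i [x zx]] := subm_valP z; exists i, x; apply: subm_inj.
Qed.

Lemma colim_ex2 y z : exists i x w, y = colim_in i x /\ z = colim_in i w.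
Proof.
have [i [x ->]] := colim_ex y; have [j [w ->]] := colim_ex z.
exists (maxn i j), (trans i (maxn i j) x), (trans j (maxn i j) w).
by rewrite !colim_trans ?leq_maxl ?leq_maxr.
Qed.

Hypothesis step_inj : forall i, injective (step i).

Lemma trans_inj i j : (i <= j)%N -> injective (trans i j).
Proof.
elim: j => [|j IHj].
  by rewrite leqn0 => /eqP i0; subst i => x y; rewrite !trans_id.
rewrite leq_eqVlt => /predU1P[->|]; first by move=> x y; rewrite !trans_id.
by rewrite ltnS => ij x y; rewrite !transS // => /step_inj /IHj; apply.
Qed.

(** If the thread of [x - y] vanishes from index [k] on, its entry at [maxn i k] is zero, and the
    transition map to that stage is injective. *)
Lemma colim_inj i : injective (colim_in i).
Proof.
move=> x y /eqP; rewrite -subr_eq0 -linearB => /eqP /(congr1 (subm_val)).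
rewrite linear0 => /quot_pi0[k xy0]; apply/eqP; rewrite -subr_eq0; apply/eqP.
apply: (@trans_inj i (maxn i k)); first exact: leq_maxl.
by rewrite linear0; apply: xy0; exact: leq_maxr.
Qed.

Lemma colim_lift (Y : lmodType S) (g : forall i, {linear N i -> Y}) :
  (forall i x, g i.+1 (step i x) = g i x) ->
  exists t : {linear colim -> Y}, forall i x, t (colim_in i x) = g i x.
Proof.
move=> gS; have gT i j x : (i <= j)%N -> g j (trans i j x) = g i x.
  elim: j => [|j IHj].
    by rewrite leqn0 => /eqP i0; subst i; rewrite trans_id.
  rewrite leq_eqVlt => /predU1P[<-|]; first by rewrite trans_id.
  by rewrite ltnS => ij; rewrite transS // gS IHj.
(* The value is read off at any representative; two representatives coincide in a common stage, by
   injectivity of that stage in the colimit. *)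
have tP z : exists y, forall i x, z = colim_in i x -> y = g i x.
  have [i [x ->]] := colim_ex z; exists (g i x) => j w xw.
  rewrite -(gT i (maxn i j)) ?leq_maxl // -(gT j (maxn i j)) ?leq_maxr //.
  congr (g _ _); apply: (@colim_inj (maxn i j)).
  by rewrite !colim_trans ?leq_maxl ?leq_maxr.
pose t z := projT1 (cid (tP z)).
have tE i x : t (colim_in i x) = g i x.
  by have /(_ i x erefl) := projT2 (cid (tP (colim_in i x))).
have lt : linear t.
  move=> a y z; have [i [x [w [-> ->]]]] := colim_ex2 y z.
  by rewrite -(linearP (colim_in i)) !tE (linearP (g i)).
by exists (lin lt).
Qed.

End Colimit.

(** * Short exact sequences and the vanishing of Ext^1 *)

Lemma eq_subr0 (V : zmodType) (x y : V) : x = y <-> x - y = 0.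
Proof. by split=> [->|/eqP]; [rewrite subrr | rewrite subr_eq0 => /eqP]. Qed.

Section ShortExact.
Variable R : pzRingType.
Implicit Types A B C E K M X Y : rmodType R.

Record ses A E C (i : {linear A -> E}) (p : {linear E -> C}) : Prop := Ses {
  ses_inj : injective i;
  ses_surj : forall c, exists e, p e = c;
  ses_exact : forall e, p e = 0 <-> exists a, i a = e }.

Lemma ker0_inj A E (i : {linear A -> E}) :
  (forall a, i a = 0 -> a = 0) -> injective i.
Proof.
by move=> i0 a b /eq_subr0 ab; apply/eq_subr0/i0; rewrite linearB.
Qed.

Section Ses.
Variables (A E C : rmodType R) (i : {linear A -> E}) (p : {linear E -> C}).
Hypothesis ip : ses i p.

Lemma ses_comp0 a : p (i a) = 0.
Proof. by apply/(ses_exact ip); exists a. Qed.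

Lemma ses_ker_lift X (f : {linear X -> E}) : (forall x, p (f x) = 0) ->
  exists g : {linear X -> A}, forall x, i (g x) = f x.
Proof.
move=> pf; have gP x := cid ((ses_exact ip _).1 (pf x)).
pose g x := projT1 (gP x); have gE x : i (g x) = f x := projT2 (gP x).
have lg : linear g.
  by move=> a x y; apply: (ses_inj ip); rewrite !(linearP, gE).
by exists (lin lg).
Qed.

Lemma ses_coker_lift Y (f : {linear E -> Y}) : (forall a, f (i a) = 0) ->
  exists g : {linear C -> Y}, forall e, g (p e) = f e.
Proof.
move=> fi; have gP c := cid (ses_surj ip c).
pose g c := f (projT1 (gP c)); have gE e : g (p e) = f e.
  apply/eq_subr0; rewrite /g -linearB.
  have [|a <-] := (ses_exact ip (projT1 (gP (p e)) - e)).1; last exact: fi.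
  by rewrite linearB (projT2 (gP (p e))) subrr.
have lg : linear g.
  move=> a x y; have [u <-] := ses_surj ip x; have [v <-] := ses_surj ip y.
  by rewrite -linearP !gE linearP.
by exists (lin lg).
Qed.

Lemma ses_section_retraction :
  (exists s : {linear C -> E}, forall c, p (s c) = c) <->
  (exists r : {linear E -> A}, forall a, r (i a) = a).
Proof.
split=> [[s ps]|[r ri]].
  have [e|r rE] := @ses_ker_lift _ (subl (idl E) (complin s p)).
    by rewrite sublE linearB complinE ps subrr.
  exists r => a; apply: (ses_inj ip).
  by rewrite rE sublE complinE ses_comp0 linear0 subr0.
have [a|s sE] := @ses_coker_lift _ (subl (idl E) (complin i r)).
  by rewrite sublE complinE ri subrr.
exists s => c; have [e <-] := ses_surj ip c.
by rewrite sE sublE complinE linearB ses_comp0 subr0.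
Qed.

End Ses.

Fact ker_smP E C (p : {linear E -> C}) a x y :
  p x = 0 -> p y = 0 -> p (a *: x + y) = 0.
Proof. by move=> px py; rewrite linearP px py scaler0 addr0. Qed.
Definition ker_sm E C (p : {linear E -> C}) : submodule E :=
  Submodule (linear0 p) (@ker_smP _ _ p).

Lemma ker_ses E C (p : {linear E -> C}) : (forall c, exists e, p e = c) ->
  ses (subm_val : {linear subm (ker_sm p) -> E}) p.
Proof.
move=> p_surj; split=> // [|e]; first exact: subm_inj.
by split=> [/(@subm_exP _ _ (ker_sm p))//|[k <-]]; exact: subm_valP k.
Qed.

Lemma ses_kernel E C (p : {linear E -> C}) : (forall c, exists e, p e = c) ->
  exists (K : rmodType R) (i : {linear K -> E}), ses i p.
Proof. by exists (subm (ker_sm p)), subm_val; exact: ker_ses. Qed.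

Lemma ses_cokernel A E (i : {linear A -> E}) : injective i ->
  exists (C : rmodType R) (p : {linear E -> C}), ses i p.
Proof.
move=> i_inj.
have kP a x y : (exists u, i u = x) -> (exists v, i v = y) ->
    exists w, i w = a *: x + y.
  by move=> [u <-] [v <-]; exists (a *: u + v); rewrite linearP.
pose K := Submodule (ex_intro (fun u => i u = 0) 0 (linear0 i)) kP.
exists (quotm K), (quot_pi K); split=> // [|e]; first exact: quot_pi_surj.
exact: quot_pi0.
Qed.

(** A retraction [r] of [i] turns [e] into the pair [(r e, p e)], an equivalence with the split
    extension; conversely the first component of an equivalence is a retraction. *)
Lemma Ext1_retraction C A : Ext1_zero C A <->
  forall E (i : {linear A -> E}) (p : {linear E -> C}), ses i p ->
  exists r : {linear E -> A}, forall a, r (i a) = a.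
Proof.
split=> [CA E i p [i_inj p_surj ip]|CA [E i p i_inj p_surj ip]].
  have [phi [_ phi_i _]] := CA (Extension i_inj p_surj ip).
  have lr : linear (fun e => (phi e).1) by move=> a x y; rewrite (linearP phi).
  by exists (lin lr) => a; rewrite linE [phi _]phi_i.
have ses_ip : ses i p by [].
have [r ri] := CA _ _ _ ses_ip.
have lphi : linear (fun e => (r e, p e)).
  by move=> a x y; rewrite (linearP r) (linearP p).
have [|s0 ps0] := (ses_section_retraction ses_ip).2; first by exists r.
exists (lin lphi); split=> // [|a]; last first.
  by rewrite linE ri (ses_comp0 ses_ip).
(* The section [s0] need not land in the kernel of [r]; subtracting its component in [A] corrects
   it. *)
exists (fun z => i z.1 + (s0 z.2 - i (r (s0 z.2)))) => [e|[a c]]; rewrite !linE /=.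
  have [|a aE] := (ip (e - s0 (p e))).1; first by rewrite linearB ps0 subrr.
  by rewrite addrCA -!linearB -aE ri aE addrC subrK.
congr pair.
  by rewrite linearD linearB !ri subrr addr0.
by rewrite linearD linearB !(ses_comp0 ses_ip) ps0 add0r subr0.
Qed.

Lemma Ext1_section C A : Ext1_zero C A <->
  forall E (i : {linear A -> E}) (p : {linear E -> C}), ses i p ->
  exists s : {linear C -> E}, forall c, p (s c) = c.
Proof.
rewrite Ext1_retraction; split=> CA E i p ip.
  by apply/(ses_section_retraction ip)/(CA _ _ _ ip).
by apply/(ses_section_retraction ip)/(CA _ _ _ ip).
Qed.

Lemma po_ses K B C X (i : {linear K -> B}) (p : {linear B -> C})
    (h : {linear K -> X}) : ses i p ->
  exists q : {linear po i h -> C}, ses (po_inr i h) q.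
Proof.
move=> ip.
have [k|q [qb qx]] := @po_lift _ _ _ _ i h _ p (zerol X C).
  by rewrite (ses_comp0 ip).
exists q; split=> [|c|z].
- apply: ker0_inj => x x0; have := (@po_eq0 _ _ _ _ i h 0 x).1.
  rewrite linear0 add0r => /(_ x0)[k [k0 ->]].
  by rewrite (_ : k = 0) ?linear0 ?oppr0 //; apply: (ses_inj ip); rewrite -k0 linear0.
- by have [b <-] := ses_surj ip c; exists (po_inl i h b).
split=> [|[x <-]]; last exact: qx.
have [b [x ->]] := po_ex z; rewrite linearD qb qx addr0 => /(ses_exact ip)[k <-].
by exists (h k + x); rewrite linearD po_comm.
Qed.

Lemma po_ses_l K B C X (i : {linear K -> X}) (p : {linear X -> C})
    (h : {linear K -> B}) : ses i p ->
  exists q : {linear po h i -> C}, ses (po_inl h i) q.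
Proof.
move=> ip.
have [k|q [qb qx]] := @po_lift _ _ _ _ h i _ (zerol B C) p.
  by rewrite (ses_comp0 ip).
exists q; split=> [|c|z].
- apply: ker0_inj => x x0; have := (@po_eq0 _ _ _ _ h i x 0).1.
  rewrite linear0 addr0 => /(_ x0)[k [-> /eqP]].
  rewrite eq_sym oppr_eq0 => /eqP k0.
  by rewrite (_ : k = 0) ?linear0 //; apply: (ses_inj ip); rewrite k0 linear0.
- by have [b <-] := ses_surj ip c; exists (po_inr h i b).
split=> [|[x <-]]; last exact: qb.
have [b [x ->]] := po_ex z; rewrite linearD qb qx add0r => /(ses_exact ip)[k <-].
by exists (b + h k); rewrite linearD po_comm.
Qed.

(** The pushout of the sequence along [f] is an extension of [C] by [X]; it splits, and its
    retraction composed with the map from [E] extends [f]. *)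
Lemma Ext1_extend A E C X (i : {linear A -> E}) (p : {linear E -> C}) :
  ses i p -> Ext1_zero C X -> forall f : {linear A -> X},
  exists g : {linear E -> X}, forall a, g (i a) = f a.
Proof.
move=> ip /Ext1_retraction CX f; have [q fq] := po_ses f ip.
have [r rE] := CX _ _ _ fq; exists (complin r (po_inl i f)) => a.
by rewrite complinE po_comm rE.
Qed.

(** The pullback of [p] along [f], a submodule of [E * X], is an extension of [X] by [A]; a section
    followed by the projection to [E] is the lift. *)
Lemma Ext1_lift A E C X (i : {linear A -> E}) (p : {linear E -> C}) :
  ses i p -> Ext1_zero X A -> forall f : {linear X -> C},
  exists g : {linear X -> E}, forall x, p (g x) = f x.
Proof.
move=> ip /Ext1_section XA f.
have k0 : p (0 : E * X).1 = f (0 : E * X).2 by rewrite !linear0.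
have kP a (x y : E * X) : p x.1 = f x.2 -> p y.1 = f y.2 ->
    p (a *: x + y).1 = f (a *: x + y).2.
  by move=> px py; rewrite (linearP p) (linearP f) px py.
pose K := Submodule k0 kP.
have lj : linear (fun a => (i a, 0) : E * X).
  by move=> a x y; rewrite linearP; congr pair; rewrite /= scaler0 addr0.
have Kj a : K (lin lj a) by rewrite /= (ses_comp0 ip) linear0.
have lq : linear (fun z : subm K => (subm_val z).2) by move=> a x y; rewrite linearP.
have lt : linear (fun z : subm K => (subm_val z).1) by move=> a x y; rewrite linearP.
have [|s sE] := XA _ (subm_fac Kj) (lin lq).
  split=> [|x|z].
  - apply: ker0_inj => a /(congr1 subm_val).
    by rewrite subm_facE linear0 => -[a0]; apply: (ses_inj ip); rewrite a0 linear0.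
  - have [e pe] := ses_surj ip (f x).
    by have [z zE] := @subm_exP _ _ K (e, x) pe; exists z; rewrite linE zE.
  rewrite linE; split=> [z0|[a <-]]; last by rewrite subm_facE.
  have := subm_valP z; rewrite /= z0 linear0 => /(ses_exact ip)[a ia].
  exists a; apply: subm_inj; rewrite subm_facE linE ia -z0.
  exact/esym/surjective_pairing.
exists (complin (lin lt) s) => x; rewrite complinE linE (subm_valP (s x)).
by congr (f _); exact: sE.
Qed.

Section ExtSes.
Variables (A B C X : rmodType R) (i : {linear A -> B}) (p : {linear B -> C}).
Hypothesis ip : ses i p.

(** Part of the long exact sequence: if Hom(X,B) maps onto Hom(X,C), the connecting map is zero and
    Ext^1(X,A) embeds into Ext^1(X,B). *)
Lemma Ext1_of_lift :
  (forall f : {linear X -> C}, exists g : {linear X -> B}, forall x, p (g x) = f x) ->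
  Ext1_zero X B -> Ext1_zero X A.
Proof.
move=> lift XB; apply/Ext1_retraction => E j q jq.
have [g gj] := Ext1_extend jq XB i.
have [a|u uq] := ses_coker_lift jq (f := complin p g).
  by rewrite complinE gj (ses_comp0 ip).
have [v pv] := lift u.
have [e|r rE] := ses_ker_lift ip (f := subl g (complin v q)).
  by rewrite sublE complinE linearB pv uq complinE subrr.
exists r => a; apply: (ses_inj ip).
by rewrite rE sublE complinE gj (ses_comp0 jq) linear0 subr0.
Qed.

(** The contravariant counterpart: if Hom(B,X) maps onto Hom(A,X), then Ext^1(C,X) embeds into
    Ext^1(B,X). *)
Lemma Ext1_of_extend :
  (forall f : {linear A -> X}, exists g : {linear B -> X}, forall a, g (i a) = f a) ->
  Ext1_zero B X -> Ext1_zero C X.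
Proof.
move=> extend BX; apply/Ext1_section => E j q jq.
have [g qg] := Ext1_lift jq BX p.
have [a|h jh] := ses_ker_lift jq (f := complin g i).
  by rewrite complinE qg (ses_comp0 ip).
have [h' h'i] := extend h.
have [a|s sE] := ses_coker_lift ip (f := subl g (complin j h')).
  by rewrite sublE complinE h'i jh complinE subrr.
exists s => c; have [b <-] := ses_surj ip c.
by rewrite sE sublE complinE linearB qg (ses_comp0 jq) subr0.
Qed.

(** Given an extension [E] of [X] by [B], the map [p] extends to [r] on [E] because Ext^1(X,C)
    vanishes. The kernel of [r] is an extension of [X] by [A], and its section is one of [E] too. *)
Lemma Ext1_mid_r : Ext1_zero X A -> Ext1_zero X C -> Ext1_zero X B.
Proof.
move=> /Ext1_section XA XC; apply/Ext1_section => E j q jq.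
have [r rj] := Ext1_extend jq XC p.
pose G := ker_sm r.
have Gji a : G (complin j i a) by rewrite complinE /= rj (ses_comp0 ip).
have [|s sE] := XA _ (subm_fac Gji) (complin q subm_val); last first.
  by exists (complin subm_val s) => x; rewrite complinE -[RHS]sE.
split=> [|x|z].
- move=> a b /(congr1 subm_val); rewrite !subm_facE !complinE.
  by move=> /(ses_inj jq)/(ses_inj ip).
- have [e <-] := ses_surj jq x; have [b pb] := ses_surj ip (r e).
  have [|z zE] := @subm_exP _ _ G (e - j b).
    by rewrite /= linearB rj pb subrr.
  by exists z; rewrite complinE zE linearB (ses_comp0 jq) subr0.
rewrite complinE; split=> [/(ses_exact jq)[b jb]|[a <-]]; last first.
  by rewrite subm_facE complinE (ses_comp0 jq).
have : r (subm_val z) = 0 := subm_valP z; rewrite -jb rj => /(ses_exact ip)[a ia].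
by exists a; apply: subm_inj; rewrite subm_facE complinE ia jb.
Qed.

(** Given an extension [E] of [B] by [X], the map [i] lifts to an embedding [g] of [A] in [E]. The
    quotient of [E] by its image is an extension of [C] by [X], and a retraction of it pulls back to
    [E]. *)
Lemma Ext1_mid_l : Ext1_zero A X -> Ext1_zero C X -> Ext1_zero B X.
Proof.
move=> AX /Ext1_retraction CX; apply/Ext1_retraction => E j q jq.
have [g qg] := Ext1_lift jq AX i.
have g_inj : injective g.
  by apply: ker0_inj => a a0; apply: (ses_inj ip); rewrite -qg a0 !linear0.
have [Q [c gc]] := ses_cokernel g_inj.
have [a|q' q'c] := ses_coker_lift gc (f := complin p q).
  by rewrite complinE qg (ses_comp0 ip).
have [|r rE] := CX _ (complin c j) q'; last by exists (complin r c) => x; exact: rE.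
split=> [|y|z].
- apply: ker0_inj => x /(ses_exact gc)[a ga].
  have a0 : a = 0.
    by apply: (ses_inj ip); rewrite -qg ga (ses_comp0 jq) linear0.
  by apply: (ses_inj jq); rewrite -ga a0 !linear0.
- have [b <-] := ses_surj ip y; have [e <-] := ses_surj jq b.
  by exists (c e); rewrite q'c.
have [e <-] := ses_surj gc z; rewrite q'c complinE.
split=> [/(ses_exact ip)[a ia]|[x]]; last first.
  move=> ce; rewrite -[p _](q'c e) -ce complinE q'c complinE.
  by rewrite (ses_comp0 jq) linear0.
have [|x jx] := (ses_exact jq (e - g a)).1; first by rewrite linearB qg ia subrr.
by exists x; rewrite complinE jx linearB (ses_comp0 gc) subr0.
Qed.

End ExtSes.

Definition injective_module (I : rmodType R) : Prop :=
  forall (U V : rmodType R) (i : {linear U -> V}) (f : {linear U -> I}),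
  injective i ->
  exists g : {linear V -> I}, forall u, g (i u) = f u.

Lemma injective_Ext1 X I : injective_module I -> Ext1_zero X I.
Proof. by move=> injI; apply/Ext1_retraction => E i p [/(injI _ _ _ (idl I))]. Qed.

Lemma projective_Ext1 M : projective M <-> forall Y, Ext1_zero M Y.
Proof.
split=> [projM Y|extM U V g f g_surj].
  by apply/Ext1_section => E i p [_ /(projM _ _ _ (idl M))].
have [K [i ig]] := ses_kernel g_surj.
exact: Ext1_lift ig (extM K) f.
Qed.

Lemma projective_Ext1_zero M Y : projective M -> Ext1_zero M Y.
Proof. by move=> /projective_Ext1. Qed.

End ShortExact.

(** * Resolutions and orthogonal dimension *)

Section Resolutions.
Variable R : pzRingType.
Implicit Types (X : mod_class R) (E K M : rmodType R).

Definition zeromod : rmodType R := 'rV[R^c]_0.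

Lemma zeromod_eq0 (x : zeromod) : x = 0.
Proof. exact: thinmx0. Qed.

Lemma zero_Ext1_l M (Z : rmodType R) : (forall z : Z, z = 0) -> Ext1_zero Z M.
Proof.
move=> Z0; apply/Ext1_section => E i p ip; exists (zerol Z E) => c.
by rewrite [LHS]Z0 [RHS]Z0.
Qed.

Lemma zero_Ext1_r M (Z : rmodType R) : (forall z : Z, z = 0) -> Ext1_zero M Z.
Proof.
move=> Z0; apply/Ext1_retraction => E i p ip; exists (zerol E Z) => c.
by rewrite [LHS]Z0 [RHS]Z0.
Qed.

Section Trivial.
Variable M : rmodType R.

Definition triv_obj (i : nat) : rmodType R := if i is 0 then M else zeromod.
Definition triv_diff i : {linear triv_obj i.+1 -> triv_obj i} :=
  zerol zeromod (triv_obj i).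

Fact triv_surj (m : M) : exists x, idl M x = m.
Proof. by exists m. Qed.
Fact triv_exact0 (x : M) : idl M x = 0 <-> exists y, triv_diff 0 y = x.
Proof. by split=> [x0|[y <-]] //; exists 0; exact/esym. Qed.
Fact triv_exact i (x : triv_obj i.+1) :
  triv_diff i x = 0 <-> exists y, triv_diff i.+1 y = x.
Proof. by split=> // _; exists 0; rewrite [x]zeromod_eq0. Qed.

Definition triv_resolution :=
  @Resolution _ M triv_obj triv_diff (idl M) triv_surj triv_exact0 triv_exact.

End Trivial.

Section Splice.
Variables (K E M : rmodType R) (i : {linear K -> E}) (p : {linear E -> M}).
Hypothesis ip : ses i p.
Variable r : resolution K.

Definition splice_obj (j : nat) : rmodType R := if j is j'.+1 then res_obj r j' else E.
Definition splice_diff j : {linear splice_obj j.+1 -> splice_obj j} :=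
  match j return {linear splice_obj j.+1 -> splice_obj j} with
  | 0 => complin i (res_aug r)
  | j'.+1 => res_diff r j'
  end.

Fact splice_exact0 e : p e = 0 <-> exists y, splice_diff 0 y = e.
Proof.
split=> [/(ses_exact ip)[k <-]|[y <-]]; last exact: (ses_comp0 ip).
by have [x <-] := res_aug_surj r k; exists x.
Qed.
Fact splice_exact j (x : splice_obj j.+1) :
  splice_diff j x = 0 <-> exists y, splice_diff j.+1 y = x.
Proof.
case: j x => [|j] x; last exact: (@res_exact _ _ r).
rewrite -[splice_diff 0 x]/(i (res_aug r x)).
split=> [x0|/(@res_exact0 _ _ r _) ->]; last exact: linear0.
by apply/(@res_exact0 _ _ r _)/(ses_inj ip); rewrite x0 linear0.
Qed.

Definition splice_resolution :=
  @Resolution _ M splice_obj splice_diff p (ses_surj ip) splice_exact0 splice_exact.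

End Splice.

Section Shift.
Variables (M : rmodType R) (r : resolution M).

(** The first syzygy with the truncated resolution. The last clause records the cover of the syzygy
    by [res_obj r 1], from which its finite generation is later read off. *)
Lemma resolution_shift : exists (K : rmodType R) (i : {linear K -> res_obj r 0})
  (r' : resolution K),
  [/\ ses i (res_aug r), forall j, res_obj r' j = res_obj r j.+1
    & exists g : {linear res_obj r 1 -> K}, forall k, exists x, g x = k].
Proof.
have [K [i ip]] := ses_kernel (@res_aug_surj _ _ r).
have [x|g gE] := ses_ker_lift ip (f := res_diff r 0).
  by apply/res_exact0; exists x.
have g_surj k : exists x, g x = k.
  have [x xk] := (@res_exact0 _ _ r (i k)).1 (ses_comp0 ip k).
  by exists x; apply: (ses_inj ip); rewrite gE.
have g_exact x : g x = 0 <-> exists y, res_diff r 1 y = x.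
  rewrite -res_exact -gE; split=> [->|x0]; first exact: linear0.
  by apply: (ses_inj ip); rewrite x0 linear0.
by exists K, i, (@Resolution _ K _ (fun j => res_diff r j.+1) g g_surj g_exact
  (fun j => @res_exact _ _ r j.+1)); split=> //; exists g.
Qed.

End Shift.

Lemma has_resolution0 X M : X M -> has_resolution X M 0.
Proof.
move=> XM; exists (triv_resolution M); split=> [i|[|i]] //.
  by rewrite leqn0 => /eqP ->.
by move=> _ x; exact: zeromod_eq0.
Qed.

Lemma has_resolution_splice X K E M (i : {linear K -> E}) (p : {linear E -> M}) k :
  ses i p -> X E -> has_resolution X K k -> has_resolution X M k.+1.
Proof.
move=> ip XE [r [Xr r0]]; exists (splice_resolution ip r).
by split=> -[|j] //=; rewrite ltnS; [exact: Xr | exact: r0].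
Qed.

(** A class need not be closed under isomorphism, so the outcome is a member of [X] isomorphic to
    [M]. *)
Lemma has_resolution0_inv X M : has_resolution X M 0 ->
  exists (E : rmodType R) (f : {linear E -> M}),
    [/\ X E, injective f & forall m, exists x, f x = m].
Proof.
move=> [r [Xr r0]]; exists (res_obj r 0), (res_aug r).
split; [exact: Xr| |exact: res_aug_surj].
apply: ker0_inj => x /res_exact0[y <-].
by rewrite (r0 1%N _ y) // linear0.
Qed.

Lemma has_resolutionS_inv X M k : has_resolution X M k.+1 ->
  exists (K E : rmodType R) (i : {linear K -> E}) (p : {linear E -> M}),
    [/\ ses i p, X E & has_resolution X K k].
Proof.
move=> [r [Xr r0]]; have [K [i [r' [ip r'E _]]]] := resolution_shift r.
exists K, (res_obj r 0), i, (res_aug r); split=> //; first exact: Xr.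
exists r'; split=> j jk; rewrite r'E; first exact: Xr.
exact: r0.
Qed.

End Resolutions.

(** * Dimension shifting along cosyzygies *)

Section Dimension.
Variable R : pzRingType.
Implicit Types (Y : mod_class R) (A B C I K M W Z : rmodType R).

(** All k-th cosyzygies of members of [Y], for every choice of injective embeddings; they replace
    higher Ext groups. *)
Fixpoint cosyzygy Y k : mod_class R :=
  if k is k'.+1 then fun Z =>
    exists (W I : rmodType R) (i : {linear W -> I}) (p : {linear I -> Z}),
      [/\ cosyzygy Y k' W, injective_module I & ses i p]
  else Y.

(* By dimension shifting this says that Ext^{k+1}(M, N) = 0 for all N in Y. *)
Definition orth_dim Y k M : Prop := forall Z, cosyzygy Y k Z -> Ext1_zero M Z.

Definition cosyzygy_closed Y : Prop := forall Z, cosyzygy Y 1 Z -> Y Z.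

Lemma orth_dim_mid Y k A B C (i : {linear A -> B}) (p : {linear B -> C}) :
  ses i p -> orth_dim Y k A -> orth_dim Y k C -> orth_dim Y k B.
Proof. by move=> ip YA YC Z YZ; apply: (Ext1_mid_l ip); [exact: YA | exact: YC]. Qed.

Lemma orth_dim_iso Y k M M' (f : {linear M -> M'}) : injective f ->
  (forall m, exists x, f x = m) -> orth_dim Y k M -> orth_dim Y k M'.
Proof.
move=> f_inj f_surj YM.
(* The isomorphic copy [M'] is viewed as an extension of the zero module by [M]. *)
apply: (@orth_dim_mid _ _ _ _ _ f (zerol M' (zeromod R))) => // [|Z _].
  by split=> [|c|e] //; exists 0; rewrite [RHS]zeromod_eq0.
apply: zero_Ext1_l; exact: zeromod_eq0.
Qed.

(** A map from [A] to [Z] lifts to [I] because Ext^1(A,W) vanishes, and then extends to [B] by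
    injectivity of [I]; hence Hom(B,Z) maps onto Hom(A,Z). *)
Lemma Ext1_cosyzygy A B C W I Z (i : {linear A -> B}) (p : {linear B -> C})
    (j : {linear W -> I}) (q : {linear I -> Z}) :
  ses i p -> injective_module I -> ses j q ->
  Ext1_zero A W -> Ext1_zero B Z -> Ext1_zero C Z.
Proof.
move=> ip injI jq AW BZ; apply: (Ext1_of_extend ip) => // f.
have [f' f'E] := Ext1_lift jq AW f; have [g gE] := injI _ _ _ f' (ses_inj ip).
by exists (complin q g) => a; rewrite complinE gE f'E.
Qed.

Section Closed.
Variable Y : mod_class R.
Hypothesis Yclosed : cosyzygy_closed Y.

Lemma cosyzygyS k Z : cosyzygy Y k.+1 Z -> cosyzygy Y k Z.
Proof.
elim: k Z => [|k IHk] Z; first exact: Yclosed.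
by move=> [W [I [i [p [/IHk YW injI ip]]]]]; exists W, I, i, p.
Qed.

Lemma orth_dimS k M : orth_dim Y k M -> orth_dim Y k.+1 M.
Proof. by move=> YM Z /cosyzygyS/YM. Qed.

Lemma orth_dim_le k l M : (k <= l)%N -> orth_dim Y k M -> orth_dim Y l M.
Proof.
move=> /subnK <- YM; elim: (l - k)%N => [|d IHd] //.
by rewrite addSn; exact: orth_dimS.
Qed.

Lemma orth_dim_right k A B C (i : {linear A -> B}) (p : {linear B -> C}) :
  ses i p -> orth_dim Y k A -> orth_dim Y k B -> orth_dim Y k.+1 C.
Proof.
move=> ip YA YB Z YZ; have [W [I [j [q [YW injI jq]]]]] := YZ.
by apply: (Ext1_cosyzygy ip injI jq); [exact: YA | exact: orth_dimS YZ].
Qed.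

Hypothesis enough_injectives : forall M, exists (I : rmodType R)
  (i : {linear M -> I}), injective_module I /\ injective i.

(** For [Z] embedded in an injective [I] with cokernel [Z'], a map from [A] to [Z'] extends to [B],
    lifts from there to [I], and is restricted back to [A]. So Hom(A,I) maps onto Hom(A,Z'). *)
Lemma orth_dim_left k A B C (i : {linear A -> B}) (p : {linear B -> C}) :
  ses i p -> orth_dim Y k B -> orth_dim Y k.+1 C -> orth_dim Y k A.
Proof.
move=> ip YB YC Z YZ; have [I [j [injI j_inj]]] := enough_injectives Z.
have [Z' [q jq]] := ses_cokernel j_inj.
have YZ' : cosyzygy Y k.+1 Z' by exists Z, I, j, q.
apply: (Ext1_of_lift jq); last exact: injective_Ext1.
move=> f; have [g gE] := Ext1_extend ip (YC _ YZ') f.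
have [h hE] := Ext1_lift jq (YB _ YZ) g.
by exists (complin h i) => x; rewrite complinE hE gE.
Qed.

End Closed.

Lemma all_cosyzygy_closed : cosyzygy_closed (fun=> True : Prop).
Proof. by []. Qed.

(** Projective dimension at most [k], as vanishing of Ext^{k+1}(M,-); [pd_le] identifies it with the
    definition by resolutions. *)
Definition pdim_le k M := orth_dim (fun=> True) k M.

Lemma orth_dim_all Y k M : pdim_le k M -> orth_dim Y k M.
Proof.
move=> PM Z YZ; apply: PM; elim: k Z YZ => //= k IHk Z.
by move=> [W [I [i [p [/IHk YW injI ip]]]]]; exists W, I, i, p.
Qed.

(** Induction on the length: passing from the first syzygy to [M] raises the bound by at most
    one. *)
Lemma has_resolution_pdim X n k M : (forall E, X E -> pdim_le n E) ->
  has_resolution X M k -> pdim_le (n + k) M.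
Proof.
move=> Xn; elim: k M => [|k IHk] M.
  rewrite addn0 => /has_resolution0_inv[E [f [/Xn En f_inj f_surj]]].
  exact: orth_dim_iso f_inj f_surj En.
move=> /has_resolutionS_inv[K [E [i [p [ip /Xn En /IHk Kn]]]]].
rewrite addnS; apply: (orth_dim_right all_cosyzygy_closed ip Kn).
by apply: orth_dim_le En; [exact: all_cosyzygy_closed | exact: leq_addr].
Qed.

End Dimension.

(** * The small object argument *)

Section SmallObject.
Variables (R : pzRingType) (J : Type) (U V : J -> rmodType R).
Variable i : forall j, {linear U j -> V j}.
Implicit Types N Y E C : rmodType R.

Definition extends_along Y : Prop := forall j (f : {linear U j -> Y}),
  exists g : {linear V j -> Y}, forall u, g (i j u) = f u.

Hypothesis i_inj : forall j, injective (i j).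
Hypothesis U_fin_gen : forall j, fin_gen (U j).
Hypothesis V_projective : forall j, projective (V j).

Section Attach.
Variable N : rmodType R.

(** The index set of all extension problems with target [N], so that one pushout solves them
    together; [classic] provides the equality test that [dsum] asks for. *)
Definition attaching : eqType := {classic {j : J & {linear U j -> N}}}.
Let UN (x : attaching) := U (projT1 x).
Let VN (x : attaching) := V (projT1 x).
Let iN : {linear dsum UN -> dsum VN} := dsum_map (fun x : attaching => i (projT1 x)).
Let hN : {linear dsum UN -> N} := dsum_lift (fun x : attaching => projT2 x).

Definition attach : rmodType R := po iN hN.
Definition attach_in : {linear N -> attach} := po_inr iN hN.

Lemma attach_in_inj : injective attach_in.
Proof.
have [|C [p ip]] := @ses_cokernel _ _ _ iN.
  by apply: dsum_map_inj => x; exact: i_inj.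
by have [q hq] := po_ses hN ip; exact: (ses_inj hq).
Qed.

Lemma attach_extend j (f : {linear U j -> N}) :
  exists g : {linear V j -> attach}, forall u, g (i j u) = attach_in (f u).
Proof.
pose x : attaching := existT _ j f.
exists (complin (po_inl iN hN) (dsum_in VN x)) => u.
have := dsum_map_in (fun x : attaching => i (projT1 x)) (x := x) u.
rewrite complinE => <-; rewrite [LHS]po_comm; congr (attach_in _).
exact: (dsum_lift_in (fun x : attaching => projT2 x) (x := x) u).
Qed.

(** The inductive step for splitting extensions by [Y]: a lift through [b] defined on [N] is
    prolonged to [attach]. *)
Lemma attach_lift Y E C (a : {linear Y -> E}) (b : {linear E -> C})
    (t : {linear N -> E}) (q : {linear attach -> C}) :
  extends_along Y -> ses a b -> (forall x, b (t x) = q (attach_in x)) ->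
  exists t' : {linear attach -> E},
    (forall x, t' (attach_in x) = t x) /\ (forall z, b (t' z) = q z).
Proof.
move=> extY ab btq.
have projVN (x : attaching) : exists w : {linear VN x -> E}, forall v,
    b (w v) = complin q (complin (po_inl iN hN) (dsum_in VN x)) v.
  exact: (V_projective _ (ses_surj ab)).
(* Projectivity of the [V j] gives a lift on the attached part, not yet compatible with [t]. *)
pose w0 := dsum_lift (fun x => projT1 (cid (projVN x))).
have w0E v : b (w0 v) = q (po_inl iN hN v).
  suff : forall v, complin b w0 v = complin q (po_inl iN hN) v by apply.
  apply: dsum_hom_ext => x m; rewrite !complinE.
  rewrite [w0 _](dsum_lift_in (fun x => projT1 (cid (projVN x)))).
  by rewrite (projT2 (cid (projVN x))) !complinE.
(* The discrepancy between [w0] and [t] on the glued part is killed by [b], so it takes values in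
   [Y]. It extends along [iN], and subtracting this extension makes the two lifts agree. *)
have [|d dE] := ses_ker_lift ab (f := subl (complin w0 iN) (complin t hN)).
  move=> u; rewrite sublE !complinE linearB w0E btq.
  by rewrite -[attach_in _](@po_comm _ _ _ _ iN hN) subrr.
have extVN (x : attaching) := cid (extY _ (complin d (dsum_in UN x))).
pose d' := dsum_lift (fun x => projT1 (extVN x)).
have d'E u : d' (iN u) = d u.
  suff : forall u, complin d' iN u = d u by apply.
  apply: dsum_hom_ext => x m; rewrite complinE.
  have -> : iN (dsum_in UN x m) = dsum_in VN x (i _ m).
    exact: (dsum_map_in (fun x : attaching => i (projT1 x))).
  rewrite [LHS](dsum_lift_in (fun x => projT1 (extVN x))).
  by rewrite (projT2 (extVN x)).
have [|t' [t'l t'r]] := @po_lift _ _ _ _ iN hN _ (subl w0 (complin a d')) t.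
  by move=> u; rewrite sublE complinE d'E dE sublE !complinE opprB addrC subrK.
exists t'; split=> // z; have [v [x ->]] := po_ex z.
rewrite !linearD t'l t'r sublE complinE linearB (ses_comp0 ab) subr0 w0E btq.
by [].
Qed.

End Attach.

Section Cell.
Variable N : rmodType R.

Fixpoint stage k : rmodType R := if k is k'.+1 then attach (stage k') else N.
Definition stage_step k : {linear stage k -> stage k.+1} := attach_in (stage k).

Let L : rmodType R := colim stage_step.

Lemma stage_step_inj k : injective (stage_step k).
Proof. exact: attach_in_inj. Qed.

(** The images of the finitely many generators all appear at one stage, the largest of theirs. *)
Lemma colim_factor (W : rmodType R) (f : {linear W -> L}) : fin_gen W ->
  exists k (g : {linear W -> stage k}), forall u, colim_in stage_step k (g u) = f u.
Proof.
move=> [n [v vE]].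
have fv m := cid (colim_ex (f (v m))).
pose k := (\max_(m < n) projT1 (fv m))%N.
have fk m : exists x, colim_in stage_step k x = f (v m).
  have [x ->] := projT2 (fv m); exists (trans stage_step (projT1 (fv m)) k x).
  by apply: colim_trans; exact: (@leq_bigmax _ (fun m => projT1 (fv m))).
(* Since the stage embeds in the colimit, factoring [f] amounts to its vanishing in the cokernel,
   which is tested on generators. *)
exists k; have [C [p cp]] := ses_cokernel (colim_inj stage_step_inj (i := k)).
have [|g gE] := ses_ker_lift cp (f := f); last by exists g.
move=> u; have [c ->] := vE u; rewrite !linear_sum big1 // => m _.
have [x xE] := fk m.
by rewrite !linearZ -xE /= (ses_comp0 cp) scaler0.
Qed.

Lemma small_object : exists (M Q : rmodType R) (e : {linear N -> M})
    (p : {linear M -> Q}),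
  [/\ ses e p, extends_along M & forall Y, extends_along Y -> Ext1_zero Q Y].
Proof.
have [Q [p ep]] := ses_cokernel (colim_inj stage_step_inj (i := 0)).
exists L, Q, (colim_in stage_step 0), p; split=> // [j f|Y extY].
  (* The map already lives at stage [k], and stage [k.+1] was built to extend it. *)
  have [k [g gE]] := colim_factor f (U_fin_gen j).
  have [h hE] := attach_extend g.
  exists (complin (colim_in stage_step k.+1) h) => u.
  by rewrite complinE hE (colim_step stage_step) gE.
apply/Ext1_section => E a b ab.
(* Compatible lifts to [E] of the maps from the stages to [Q]. They start from zero because [N] dies
   in [Q], so their colimit kills [N] and descends to a section on [Q]. *)
pose T k := {t : {linear stage k -> E} |
  forall x, b (t x) = p (colim_in stage_step k x)}.
have TS k (t : T k) : {t' : T k.+1 | forall x,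
    projT1 t' (stage_step k x) = projT1 t x}.
  have [|t' [t't bt']] := cid (@attach_lift _ _ _ _ a b (projT1 t)
    (complin p (colim_in stage_step k.+1)) extY ab _).
    by move=> x; rewrite complinE (colim_step stage_step) (projT2 t).
  by exists (exist _ t' bt').
have t0 x : b (zerol N E x) = p (colim_in stage_step 0 x).
  by rewrite (ses_comp0 ep) linear0.
pose T0 : T 0 := exist _ (zerol N E) t0.
pose t := fix t k : T k := if k is k'.+1 then projT1 (TS _ (t k')) else T0.
have [k x|s sE] := @colim_lift _ _ _ stage_step_inj _ (fun k => projT1 (t k)).
  exact: (projT2 (TS k (t k))).
have [x|r rE] := ses_coker_lift ep (f := s).
  exact: sE.
exists r => c; have [l <-] := ses_surj ep c; rewrite rE.
by have [k [x ->]] := colim_ex l; rewrite sE (projT2 (t k)).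
Qed.

End Cell.
End SmallObject.

(** * Enough projectives and injectives *)

Section Projectives.
Variable R : pzRingType.
Implicit Types M N Y : rmodType R.

Lemma dsum_projective (X : eqType) (P : X -> rmodType R) :
  (forall x, projective (P x)) -> projective (dsum P).
Proof.
move=> projP A B g f g_surj.
have liftP x := cid (projP x A B g (complin f (dsum_in P x)) g_surj).
exists (dsum_lift (fun x => projT1 (liftP x))).
suff : forall v, complin g (dsum_lift (fun x => projT1 (liftP x))) v = f v by apply.
apply: dsum_hom_ext => x m; rewrite complinE.
by rewrite (dsum_lift_in (fun x => projT1 (liftP x))) (projT2 (liftP x)).
Qed.

Definition regmod : rmodType R := (R^c)^o.

Fact reg_hom_linear M (m : M) : linear (fun r : regmod => (r : R^c) *: m).
Proof. by move=> a r s; rewrite scalerDl -scalerA. Qed.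
Definition reg_hom M (m : M) : {linear regmod -> M} := lin (reg_hom_linear m).

Lemma reg_hom1 M (m : M) : reg_hom m (1 : R^c) = m.
Proof. exact: scale1r. Qed.

Lemma reg_homP M (f : {linear regmod -> M}) r : f r = (r : R^c) *: f (1 : R^c).
Proof. by rewrite -linearZ; congr (f _); exact/esym/mulr1. Qed.

Lemma regmod_projective : projective regmod.
Proof.
move=> A B g f g_surj; have [u gu] := g_surj (f (1 : R^c)).
by exists (reg_hom u) => r; rewrite [RHS]reg_homP -gu -linearZ.
Qed.

Lemma enough_projectives M : exists (P : rmodType R) (p : {linear P -> M}),
  projective P /\ forall m, exists x, p x = m.
Proof.
exists (dsum (fun _ : M => regmod)), (dsum_lift (fun m => reg_hom m)).
split=> [|m]; first by apply: dsum_projective => _; exact: regmod_projective.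
exists (dsum_in (fun _ : M => regmod) m (1 : R^c)).
by rewrite (dsum_lift_in (fun m => reg_hom m)) reg_hom1.
Qed.

Fact rv_hom_linear n M (v : 'I_n -> M) :
  linear (fun c : 'rV[R^c]_n => \sum_k c ord0 k *: v k).
Proof.
move=> a c d; rewrite scaler_sumr -big_split; apply: eq_bigr => k _ /=.
by rewrite !mxE scalerDl scalerA.
Qed.
Definition rv_hom n M (v : 'I_n -> M) : {linear ('rV[R^c]_n : rmodType R) -> M} :=
  lin (rv_hom_linear v).

Lemma rv_homP n M (f : {linear ('rV[R^c]_n : rmodType R) -> M}) c :
  f c = \sum_k c ord0 k *: f (delta_mx ord0 k).
Proof.
rewrite [c in LHS]row_sum_delta linear_sum; apply: eq_bigr => k _.
exact: linearZ.
Qed.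

Lemma rv_projective n : projective ('rV[R^c]_n : rmodType R).
Proof.
move=> A B g f g_surj; have uP k := cid (g_surj (f (delta_mx ord0 k))).
exists (rv_hom (fun k => projT1 (uP k))) => c; rewrite [RHS]rv_homP linE linear_sum.
by apply: eq_bigr => k _; rewrite linearZ (projT2 (uP k)).
Qed.

End Projectives.

(** * Baer's criterion *)

Section Baer.
Variables (R : pzRingType) (I : rmodType R).
Hypothesis extend_ideals : forall (K : submodule (regmod R))
  (f : {linear subm K -> I}),
  exists g : {linear regmod R -> I}, forall r, g (subm_val r) = f r.

Section Extension.
Variables (U V : rmodType R) (i : {linear U -> V}) (f : {linear U -> I}).
Hypothesis i_inj : injective i.

(** Graphs of linear extensions of [f] to submodules of [V] containing the image of [i]; the last
    clause is single-valuedness. *)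
Definition partial_graph (G : set (V * I)) : Prop :=
  [/\ forall a x y, G x -> G y -> G (a *: x + y),
      forall u, G (i u, f u)
    & forall y, G (0, y) -> y = 0].

Lemma range_graph : partial_graph [set z | exists u, z = (i u, f u)]%classic.
Proof.
split=> [a _ _ [u ->] [v ->]|u|y [u [u0 ->]]]; last 2 first.
- by exists u.
- by rewrite (_ : u = 0) ?linear0 //; apply: i_inj; rewrite -u0 linear0.
by exists (a *: u + v); rewrite (linearP i) (linearP f).
Qed.

Lemma max_graph : exists G, partial_graph G /\
  forall G', partial_graph G' -> (G `<=` G')%classic -> (G' `<=` G)%classic.
Proof.
(* The union of the empty chain is empty, hence the condition is imposed on nonempty sets only. A
   maximal set is nonempty, since the empty one lies strictly inside the graph on the image of
   [i]. *)
pose P (G : set (V * I)) := (exists z, G z) -> partial_graph G.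
have [F FP Ftot|G [PG Gmax]] := @Zorn_bigcup _ P.
  move=> [z [G0 FG0 G0z]]; split=> [a x y [G FG Gx] [H FH Hy]|u|y [G FG G0y]].
  - have [GH|HG] := Ftot _ _ FG FH.
      have [HP _ _] := FP _ FH (ex_intro _ _ Hy).
      by exists H => //; apply: HP => //; exact: GH.
    have [GP _ _] := FP _ FG (ex_intro _ _ Gx).
    by exists G => //; apply: GP => //; exact: HG.
  - by exists G0 => //; have [_ G0f _] := FP _ FG0 (ex_intro _ _ G0z).
  by have [_ _] := FP _ FG (ex_intro _ _ G0y); apply.
have PG' : partial_graph G.
  apply: PG; apply: contrapT => G0.
  apply: (Gmax [set z | exists u, z = (i u, f u)]%classic _ _).
    split=> [z Gz|sub]; first by case: G0; exists z.
    by apply: G0; exists (i 0, f 0); apply: sub; exists 0.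
  by move=> _; exact: range_graph.
exists G; split=> // G' PG1 GG'; apply: contrapT => G'G.
by apply: (Gmax G' _ _) => // _.
Qed.

Lemma baer_extend : exists g : {linear V -> I}, forall u, g (i u) = f u.
Proof.
have [G [[GP Gf G0] Gmax]] := max_graph.
have G00 : G (0, 0) by have := Gf 0; rewrite !linear0.
have GZ a x : G x -> G (a *: x).
  by move=> Gx; rewrite -[_ *: _]addr0; exact: GP.
have Guniq v x y : G (v, x) -> G (v, y) -> x = y.
  move=> vx vy; apply/eq_subr0/G0; have := GP (-1) _ _ vy vx.
  rewrite scaleN1r addrC (_ : (v, x) - (v, y) = (0, x - y)) //.
  by congr pair; exact: subrr.
have Gtot v : exists x, G (v, x).
  have kP a (r s : regmod R) : (exists x, G ((r : R^c) *: v, x)) ->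
      (exists x, G ((s : R^c) *: v, x)) ->
      exists x, G ((a *: r + s : R^c) *: v, x).
    move=> [x Gx] [y Gy]; exists (a *: x + y); have := GP a _ _ Gx Gy.
    congr (G (_, _)); rewrite scalerDl; congr (_ + _); exact: scalerA.
  have k0 : exists x, G (((0 : regmod R) : R^c) *: v, x).
    by exists 0; rewrite (_ : _ *: v = 0) //; exact: scale0r.
  (* The ideal of scalars carrying [v] into the domain of [G]. The map [h] reads off the values
     there, and its extension to the ring proposes [y = g 1] as the value at [v]. *)
  pose K := Submodule (sm_pred := fun r : regmod R =>
    exists x, G ((r : R^c) *: v, x)) k0 kP.
  pose h (r : subm K) := projT1 (cid (subm_valP r)).
  have hE (r : subm K) : G ((subm_val r : R^c) *: v, h r).
    exact: projT2 (cid (subm_valP r)).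
  have lh : linear h.
    move=> a r s; apply: (Guniq ((subm_val (a *: r + s) : R^c) *: v)) => //.
    have := GP a _ _ (hE r) (hE s); congr (G (_, _)).
    rewrite linearP scalerDl; congr (_ + _); exact: scalerA.
  have [g gE] := extend_ideals (lin lh).
  pose y := g (1 : R^c).
  pose G' := [set z | exists (r : R^c) w,
    G w /\ z = (w.1 + r *: v, w.2 + r *: y)]%classic.
  suff PG' : partial_graph G'.
    exists y; apply: (Gmax G' PG') => [[w x] Gw|]; last first.
      by exists 1, (0, 0); rewrite /= !add0r !scale1r.
    by exists 0, (w, x); rewrite /= !scale0r !addr0.
  split=> [a _ _ [r [[w x] [Gw ->]]] [s [[w' x'] [Gw' ->]]]|u|z].
  - exists (a *: (r : regmod R) + s), (a *: (w, x) + (w', x')).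
    split; first exact: GP.
    by congr pair; rewrite /= scalerDr scalerDl addrACA -!scalerA.
  - by exists 0, (i u, f u); rewrite /= !scale0r !addr0.
  (* If [w + r *: v = 0] then [r] lies in [K], and [r *: y = h r = - x] by uniqueness of values in
     [G]. *)
  move=> [r [[w x] [Gw [/= w0 ->]]]].
  have Gr : G (r *: v, - x).
    have := GZ (-1) _ Gw; congr (G (_, _)); last exact: scaleN1r.
    by rewrite /= scaleN1r; apply/eqP; rewrite eq_sym -addr_eq0 addrC -w0.
  have [k kE] := @subm_exP _ _ K r (ex_intro _ _ Gr).
  have -> : r *: y = - x.
    rewrite -(reg_homP g r) -kE gE; apply: (Guniq (r *: v)) => //.
    by have := hE k; rewrite kE.
  exact: subrr.
have gP v := cid (Gtot v).
have lg : linear (fun v => projT1 (gP v)).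
  move=> a v w; apply: (Guniq (a *: v + w)); first exact: projT2 (gP _).
  exact: GP (projT2 (gP v)) (projT2 (gP w)).
by exists (lin lg) => u; apply: (Guniq (i u)); [exact: projT2 (gP _) | exact: Gf].
Qed.

End Extension.

Lemma baer : injective_module I.
Proof. by move=> U V i f i_inj; exact: baer_extend. Qed.

End Baer.

(** * Finitely generated right ideals and enough injectives *)

Section Noetherian.
Variable R : pzRingType.
Hypothesis noethR : right_noetherian R.

Definition in_span (M : rmodType R) (l : seq M) (x : M) : Prop :=
  exists c : nat -> R^c, x = \sum_(k < size l) c k *: l`_k.

Lemma in_spanP (M : rmodType R) (l : seq M) a x y :
  in_span l x -> in_span l y -> in_span l (a *: x + y).
Proof.
move=> [c ->] [d ->]; exists (fun k => a * c k + d k).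
rewrite scaler_sumr -big_split; apply: eq_bigr => k _ /=.
by rewrite scalerDl scalerA.
Qed.

Lemma in_span0 (M : rmodType R) (l : seq M) : in_span l 0.
Proof. by exists (fun=> 0); rewrite big1 // => k _; rewrite scale0r. Qed.

Lemma in_span_head (M : rmodType R) (l : seq M) x : in_span (x :: l) x.
Proof.
exists (fun k => (k == 0)%:R); rewrite big_ord_recl /= scale1r big1 ?addr0 //.
by move=> k _; rewrite scale0r.
Qed.

Lemma in_span_cons (M : rmodType R) (l : seq M) x y :
  in_span l x -> in_span (y :: l) x.
Proof.
move=> [c ->]; exists (fun k => if k is k'.+1 then c k' else 0).
by rewrite big_ord_recl /= scale0r add0r.
Qed.

(** Otherwise one keeps choosing an element outside the span of the previous ones, and the spans
    form an ascending chain of right ideals that never stops. *)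
Lemma right_ideal_fin_gen (K : submodule (regmod R)) : fin_gen (subm K).
Proof.
apply: contrapT => nfg.
have step (l : seq (subm K)) : exists x, ~ in_span l x.
  apply: contrapT => all_in; apply: nfg; exists (size l), (fun k => l`_k) => x.
  have [[c ->]|nx] := pselect (in_span l x); first by exists (fun k => c k).
  by case: all_in; exists x.
pose next l := projT1 (cid (step l)).
pose l := fix l n := if n is n'.+1 then next (l n') :: l n' else [::].
pose I n : set R := [set r | exists x, in_span (l n) x /\ subm_val x = r]%classic.
have [n|n x [y [ly yx]]|N NP] := noethR (I := I).
- split=> [|x y [u [lu <-]] [v [lv <-]]|x r [u [lu <-]]].
  + by exists 0; split; [exact: in_span0 | exact: linear0].
  + exists (u + v); split; last exact: linearD.
    by rewrite -[u]scale1r; exact: in_spanP.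
  + exists ((r : R^c) *: u); split; last exact: linearZ.
    by rewrite -[_ *: _]addr0; apply: in_spanP => //; exact: in_span0.
- by exists y; split=> //; exact: in_span_cons.
have : I N.+1 (subm_val (next (l N))).
  by exists (next (l N)); split=> //; exact: in_span_head.
rewrite (NP N.+1) // => -[x [lx /subm_inj xE]].
by apply: (projT2 (cid (step (l N)))); rewrite -/(next _) -xE.
Qed.

(** The small object argument is run on the inclusions of right ideals in the ring; extension along
    these is the hypothesis of [baer]. *)
Lemma enough_injectives (M : rmodType R) : exists (I : rmodType R)
  (i : {linear M -> I}), injective_module I /\ injective i.
Proof.
have [] := @small_object R (submodule (regmod R)) (fun K => subm K)
  (fun=> regmod R) (fun K => subm_val) (fun K => subm_inj)
  (@right_ideal_fin_gen) (fun=> @regmod_projective R) M.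
move=> I [Q [i [p [ip extI _]]]]; exists I, i; split; last exact: ses_inj ip.
exact: baer extI.
Qed.

End Noetherian.

(** * The cotorsion pair generated by P^{<oo} *)

Section FinitelyGenerated.
Variable R : pzRingType.
Implicit Types A B M : rmodType R.

Lemma fin_gen_rv n : fin_gen ('rV[R^c]_n : rmodType R).
Proof.
exists n, (fun k => delta_mx ord0 k) => x; exists (fun k => x ord0 k).
exact: row_sum_delta.
Qed.

Lemma fin_gen_add A B M (f : {linear A -> M}) (g : {linear B -> M}) :
  fin_gen A -> fin_gen B -> (forall x, exists a b, x = f a + g b) -> fin_gen M.
Proof.
move=> [m [v vE]] [n [w wE]] fg; exists (m + n)%N.
exists (fun k => match split k with inl j => f (v j) | inr j => g (w j) end) => x.
have [a [b ->]] := fg x; have [c ->] := vE a; have [d ->] := wE b.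
exists (fun k => match split k with inl j => c j | inr j => d j end).
rewrite big_split_ord !linear_sum; congr (_ + _); apply: eq_bigr => k _.
  by rewrite (unsplitK (inl k)) linearZ.
by rewrite (unsplitK (inr k)) linearZ.
Qed.

Lemma fin_gen_cover M : fin_gen M ->
  exists n (q : {linear ('rV[R^c]_n : rmodType R) -> M}),
  forall m, exists x, q x = m.
Proof.
move=> [n [v vE]]; exists n, (rv_hom v) => m; have [c ->] := vE m.
by exists (\row_k c k); apply: eq_bigr => k _; rewrite mxE.
Qed.

(** The projective in degree 0 is replaced by a free module covering it, with the kernel still
    finitely generated. *)
Lemma small_mod_presentation M : small_mod M ->
  exists n (K : submodule ('rV[R^c]_n : rmodType R))
    (p : {linear ('rV[R^c]_n : rmodType R) -> M}),
    fin_gen (subm K) /\ ses (subm_val : {linear subm K -> _}) p.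
Proof.
move=> [r rE]; have [K1 [i [r' [ip _ [g g_surj]]]]] := resolution_shift r.
have [projP fgP] := rE 0; have [_ fgP1] := rE 1%N.
have [n [q q_surj]] := fin_gen_cover fgP.
have [t qt] := projP _ _ q (idl _) q_surj.
pose p := complin (res_aug r) q.
pose K := ker_sm p; exists n, K, p; split; last first.
  apply: ker_ses => m; have [y <-] := res_aug_surj r m.
  by have [x <-] := q_surj y; exists x.
have Kt x : K (complin t (complin i g) x).
  by rewrite -[K _]/(p _ = 0) !complinE qt (ses_comp0 ip).
have Kq x : K (subl (idl _) (complin t q) x).
  by rewrite -[K _]/(p _ = 0) complinE sublE complinE linearB qt subrr linear0.
(* With [t] a section of [q], write [x = t (q x) + (x - t (q x))]: the first term comes from the
   degree 1 projective, the second from the free module. *)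
apply: (fin_gen_add (f := subm_fac Kt) (g := subm_fac Kq) fgP1 (fin_gen_rv n)) => x.
have px : res_aug r (q (subm_val x)) = 0 by exact: (subm_valP x).
have [k ik] := (ses_exact ip _).1 px; have [y gy] := g_surj k.
exists y, (subm_val x); apply: subm_inj.
by rewrite linearD !subm_facE !complinE gy ik sublE complinE addrC subrK.
Qed.

End FinitelyGenerated.

(** * Projective dimension: extended real values and Ext-vanishing *)

Section DimensionValues.
Variable R : pzRingType.
Hypothesis noethR : right_noetherian R.
Implicit Types (X Y : mod_class R) (M : rmodType R).
Local Notation natE n := (n%:R%:E : \bar Rdefinitions.R).

Lemma projective_pdim M : projective M <-> pdim_le 0 M.
Proof. by rewrite projective_Ext1; split=> [extM Y _|extM Y]; exact: extM. Qed.

(** From Ext-vanishing to resolutions: the kernel of a projective cover of [M] has dimension one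
    less, by [orth_dim_left]; at 0 the module itself is projective. *)
Lemma pdim_has_resolution k M : has_resolution projective M k <-> pdim_le k M.
Proof.
split=> [|Mk].
  by apply: (@has_resolution_pdim _ projective 0%N) => E /projective_pdim.
elim: k M Mk => [M /projective_pdim|k IHk M Mk]; first exact: has_resolution0.
have [P [p [projP p_surj]]] := enough_projectives M.
have [K [i ip]] := ses_kernel p_surj.
apply: (has_resolution_splice ip) => //; apply: IHk.
apply: (orth_dim_left (enough_injectives noethR) ip) Mk.
by apply: orth_dim_le (leq0n k) _; [exact: all_cosyzygy_closed | exact/projective_pdim].
Qed.

Lemma resdim_ge X M n :
  (forall k, has_resolution X M k -> (n <= k)%N) -> (natE n <= resdim X M)%E.
Proof.
by move=> nk; apply: le_ereal_inf_tmp => _ [k /nk nk' ->]; rewrite lee_fin ler_nat.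
Qed.

Lemma resdim_le X M k : has_resolution X M k -> (resdim X M <= natE k)%E.
Proof. by move=> XM; apply: ereal_inf_lbound; exists k. Qed.

Lemma resdim_finite X M : (resdim X M < +oo)%E <-> exists k, has_resolution X M k.
Proof.
split=> [|[k /resdim_le Mk]]; last exact: le_lt_trans Mk (ltry _).
move=> /ereal_inf_lt[_ [k Mk _] _]; by exists k.
Qed.

Lemma pd_gt M n : ~ pdim_le n M -> (natE n.+1 <= pd M)%E.
Proof.
move=> nMn; apply: resdim_ge => k /pdim_has_resolution Mk.
rewrite ltnNge; apply/negP => kn.
by apply: nMn; apply: orth_dim_le kn Mk; exact: all_cosyzygy_closed.
Qed.

Lemma pd_le M n : (pd M <= natE n)%E <-> pdim_le n M.
Proof.
split=> [Mn|/pdim_has_resolution]; last exact: resdim_le.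
apply: contrapT => /pd_gt /le_trans/(_ Mn).
by rewrite lee_fin ler_nat ltnn.
Qed.

Lemma pd_ge0 M : (0 <= pd M)%E.
Proof. by apply: (@resdim_ge projective M 0). Qed.

Lemma finite_pdP M : finite_pd M <-> exists k, pdim_le k M.
Proof.
split=> [/resdim_finite[k /pdim_has_resolution]|[k /pdim_has_resolution Mk]].
  by exists k.
by apply/resdim_finite; exists k.
Qed.

Lemma pd_class_le Y n :
  (pd_class Y <= natE n)%E <-> forall M, Y M -> pdim_le n M.
Proof.
split=> [Yn M YM|Yn]; first by apply/pd_le/(le_trans _ Yn)/ereal_sup_ubound; exists M.
by apply: ge_ereal_sup => _ [M /Yn /pd_le Mn ->].
Qed.

Lemma pd_class_ge Y M : Y M -> (pd M <= pd_class Y)%E.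
Proof. by move=> YM; apply: ereal_sup_ubound; exists M. Qed.

Lemma pd_class_sub X Y : (forall M, X M -> Y M) -> (pd_class X <= pd_class Y)%E.
Proof. by move=> XY; apply: ge_ereal_sup => _ [M /XY YM ->]; exact: pd_class_ge. Qed.

(** A member of the class, which keeps the supremum [findim] from being -oo. *)
Lemma zero_small_finite_pd : small_finite_pd (zeromod R).
Proof.
have proj0 : projective (zeromod R).
  by apply/projective_Ext1 => Y; apply: zero_Ext1_l; exact: zeromod_eq0.
split; first by apply/finite_pdP; exists 0; exact/projective_pdim.
exists (triv_resolution (zeromod R)) => i.
rewrite (_ : res_obj _ i = zeromod R); last by case: i.
split=> //; exists 0, (fun=> 0) => x; exists (fun=> 0).
by rewrite big_ord0 [x]zeromod_eq0.
Qed.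

Lemma findim_nat : (findim R < +oo)%E -> exists n,
  [/\ findim R = natE n, forall M, small_finite_pd M -> pdim_le n M
    & forall m, (forall M, small_finite_pd M -> pdim_le m M) -> (n <= m)%N].
Proof.
move=> fin; have ge0 : (0 <= findim R)%E.
  exact: le_trans (pd_ge0 _) (pd_class_ge zero_small_finite_pd).
have ex : exists n, `[< forall M : rmodType R, small_finite_pd M -> pdim_le n M >].
  move: fin ge0; case E : (findim R) => [r| |] // _; rewrite lee_fin => r0.
  exists (Num.bound r); apply/asboolP/pd_class_le; rewrite -/(findim R) E lee_fin.
  exact/ltW/archi_boundP.
case: (ex_minnP ex) => n /asboolP nP n_min; exists n; split=> //; last first.
  by move=> m mP; apply/n_min/asboolP.
apply/eqP; rewrite eq_le; apply/andP; split; first exact/pd_class_le.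
case: n nP n_min => [//|n] nP n_min; rewrite leNgt; apply/negP => lt_n.
suff /n_min : `[< forall M : rmodType R, small_finite_pd M -> pdim_le n M >].
  by rewrite ltnn.
(* Dimensions are integral: a supremum strictly below [n.+1] makes [n] a bound already, against
   minimality. *)
apply/asboolP => M SM; apply: contrapT => /pd_gt nM.
have := le_lt_trans (le_trans nM (pd_class_ge SM)) lt_n.
by rewrite ltxx.
Qed.

End DimensionValues.

(** * Approximations, heredity and the dimension of the kernel *)

Section Cotorsion.
Variable R : pzRingType.
Hypothesis noethR : right_noetherian R.
Implicit Types C K M N Y : rmodType R.
Let Acot : mod_class R := cot_left small_finite_pd.
Let Bcot : mod_class R := cot_right small_finite_pd.
Let omega : mod_class R := cot_kernel small_finite_pd.

(* Presentations R^n / K, up to isomorphism, of the modules in the generating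
   class; unlike that class they are indexed by a small type. *)
Definition presentation := {nK : {n & submodule ('rV[R^c]_n : rmodType R)} |
  fin_gen (subm (projT2 nK)) /\
  exists (C : rmodType R) (p : {linear ('rV[R^c]_(projT1 nK) : rmodType R) -> C}),
    small_finite_pd C /\ ses (subm_val : {linear subm (projT2 nK) -> _}) p}.

Definition pres_incl (j : presentation) :
  {linear subm (projT2 (projT1 j)) -> ('rV[R^c]_(projT1 (projT1 j)) : rmodType R)} :=
  subm_val.

(** For a presentation with free middle term, Ext^1(C,Y) is the cokernel of restricting maps to the
    relation module [K]. *)
Lemma cot_right_extends Y : Bcot Y <-> extends_along pres_incl Y.
Proof.
split=> [BY [[n K] [fgK [C [p [SC Kp]]]]] f|extY C SC].
  exact: Ext1_extend Kp (BY _ SC) f.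
have [_ /small_mod_presentation[n [K [p [fgK Kp]]]]] := SC.
apply: (Ext1_of_extend Kp) => [f|]; last first.
  exact/projective_Ext1_zero/rv_projective.
have nKP : fin_gen (subm K) /\ exists (C : rmodType R)
    (p : {linear ('rV[R^c]_n : rmodType R) -> C}),
    small_finite_pd C /\ ses (subm_val : {linear subm K -> _}) p.
  by split=> //; exists C, p.
exact: (extY (exist _ (existT _ n K) nKP) f).
Qed.

Lemma cot_preenvelope N : exists (M Q : rmodType R) (e : {linear N -> M})
  (p : {linear M -> Q}), [/\ ses e p, Bcot M & Acot Q].
Proof.
have [||| M [Q [e [p [ep extM QP]]]]] := @small_object _ _ _ _ pres_incl _ _ _ N.
- by move=> j; exact: subm_inj.
- by case=> nK [].
- by move=> j; exact: rv_projective.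
exists M, Q, e, p; split=> //; first exact/cot_right_extends.
by move=> Y /cot_right_extends; exact: QP.
Qed.

(* Salce's construction of precovers from preenvelopes. *)
Lemma cot_precover C : exists (K W : rmodType R) (i : {linear K -> W})
  (p : {linear W -> C}), [/\ ses i p, Bcot K & Acot W].
Proof.
have [P [p [projP p_surj]]] := enough_projectives C.
have [K [i ip]] := ses_kernel p_surj.
have [M [Q [e [q [eq BM AQ]]]]] := cot_preenvelope K.
(* The pushout is an extension of [C] by [M] and also of [Q] by [P]; the second reading places it in
   [Acot]. *)
have [p' ip'] := po_ses e ip; have [q' eq'] := po_ses_l i eq.
exists M, (po i e), (po_inr i e), p'; split=> // Y BY.
by apply: (Ext1_mid_l eq'); [exact: projective_Ext1_zero | exact: AQ].
Qed.

Lemma small_finite_pd_syzygy C : small_finite_pd C ->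
  exists (K P : rmodType R) (i : {linear K -> P}) (p : {linear P -> C}),
    [/\ ses i p, projective P & small_finite_pd K].
Proof.
move=> [finC [r rE]]; have [K [i [r' [ip r'E _]]]] := resolution_shift r.
have [projP _] := rE 0.
exists K, (res_obj r 0), i, (res_aug r); split=> //; split; last first.
  by exists r' => j; rewrite r'E.
have [k Ck] := (finite_pdP noethR C).1 finC; apply/(finite_pdP noethR); exists k.
apply: (orth_dim_left (enough_injectives noethR) ip).
  by apply: orth_dim_le (leq0n k) _; [exact: all_cosyzygy_closed | exact/projective_pdim].
by apply: orth_dimS Ck; exact: all_cosyzygy_closed.
Qed.

(** Heredity of the pair: Ext^1(C,Z) is Ext^2(C,W), hence Ext^1(K,W) for a syzygy [K] of [C], and
    [K] is again in the generating class. *)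
Lemma cot_right_cosyzygy : cosyzygy_closed Bcot.
Proof.
move=> Z [W [I [j [q [BW injI jq]]]]] C SC.
have [K [P [i [p [ip projP SK]]]]] := small_finite_pd_syzygy SC.
by apply: (Ext1_cosyzygy ip injI jq); [exact: BW | exact: projective_Ext1_zero].
Qed.

(** The middle term of a precover of [C] is in [omega], as [Bcot] is closed under extensions, and
    its kernel has dimension one less relative to [Bcot]. Dimension 0 relative to [Bcot] means
    membership in [Acot]. *)
Lemma cot_right_has_resolution k C :
  Bcot C -> orth_dim Bcot k C -> has_resolution omega C k.
Proof.
elim: k C => [|k IHk] C BC Ck; first exact: has_resolution0.
have [K [W [i [p [ip BK AW]]]]] := cot_precover C.
have BW : Bcot W by move=> D SD; apply: (Ext1_mid_r ip); [exact: BK | exact: BC].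
apply: (has_resolution_splice ip) => //; apply: IHk => //.
apply: (orth_dim_left (enough_injectives noethR) ip) Ck.
exact: (orth_dim_le cot_right_cosyzygy (leq0n k) AW).
Qed.

Lemma cot_left_pdim n : (forall M, small_finite_pd M -> pdim_le n M) ->
  forall M, Acot M -> pdim_le n M.
Proof. by move=> Sn M AM Z nZ; apply: AM => C /Sn; apply. Qed.

Lemma small_cot_left M : small_finite_pd M -> Acot M.
Proof. by move=> SM Y; apply. Qed.

Lemma cot_left_preenvelope M : Acot M -> exists (W Q : rmodType R)
  (e : {linear M -> W}) (p : {linear W -> Q}), [/\ ses e p, omega W & Acot Q].
Proof.
move=> AM; have [W [Q [e [p [ep BW AQ]]]]] := cot_preenvelope M.
exists W, Q, e, p; split=> //; split=> // Y BY.
by apply: (Ext1_mid_l ep); [exact: AM | exact: AQ].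
Qed.

Lemma finite_pd_resdim n M : (forall C, small_finite_pd C -> pdim_le n C) ->
  (pd M <= resdim Acot M + n%:R%:E)%E.
Proof.
move=> Sn; rewrite -leeBlDr //; apply: le_ereal_inf_tmp => _ [k AMk ->].
rewrite leeBlDr // -EFinD -natrD; apply/(pd_le noethR).
rewrite addnC; apply: has_resolution_pdim AMk; exact: cot_left_pdim.
Qed.

Lemma omega_zeromod : omega (zeromod R).
Proof.
split; first exact/small_cot_left/zero_small_finite_pd.
by move=> C _; apply: zero_Ext1_r; exact: zeromod_eq0.
Qed.

Lemma pd_class_omega : (findim R < +oo)%E -> pd_class omega = findim R.
Proof.
move=> fin; have [n [-> Sn n_min]] := findim_nat noethR fin.
apply/eqP; rewrite eq_le; apply/andP; split.
  by apply/(pd_class_le noethR) => M [AM _]; exact: cot_left_pdim AM.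
(* For [findim] equal to 0 it suffices that [omega] has a member. *)
case: n Sn n_min => [_ _|n Sn n_min].
  exact: le_trans (pd_ge0 _) (pd_class_ge omega_zeromod).
rewrite leNgt; apply/negP => omega_lt.
suff /n_min : forall M, small_finite_pd M -> pdim_le n M by rewrite ltnn.
move=> M SM.
have [W [Q [e [p [ep oW AQ]]]]] := cot_left_preenvelope (small_cot_left SM).
(* With [Q] of dimension at most [n.+1] and [W] at most [n], every such [M] would have dimension at
   most [n], against minimality of [n.+1]. *)
apply: (orth_dim_left (enough_injectives noethR) ep); last exact: cot_left_pdim AQ.
apply: contrapT => /(pd_gt noethR) nW.
by have := le_lt_trans (le_trans nW (pd_class_ge oW)) omega_lt; rewrite ltxx.
Qed.

Lemma wedge_omega_finite_pd : (findim R < +oo)%E ->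
  forall M, wedge omega M -> finite_pd M.
Proof.
move=> fin M /resdim_finite[k oMk]; have [n [_ Sn _]] := findim_nat noethR fin.
apply/(finite_pdP noethR); exists (n + k)%N; apply: has_resolution_pdim oMk.
by move=> E [AE _]; exact: cot_left_pdim AE.
Qed.

Lemma finite_pd_le_wedge_omega n : (forall M, small_finite_pd M -> pdim_le n M) ->
  (forall M, wedge omega M -> pdim_le n M) -> forall M, finite_pd M -> pdim_le n M.
Proof.
move=> Sn wn M /(finite_pdP noethR)[k Mk].
have [W [Q [e [p [ep BW AQ]]]]] := cot_preenvelope M.
have Qn := cot_left_pdim Sn AQ.
have all_le l m N := orth_dim_le (@all_cosyzygy_closed R) (k := l) (l := m) (M := N).
apply: (orth_dim_left (enough_injectives noethR) ep); last exact: all_le Qn.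
(* As an extension of [Q] by [M], the module [W] has dimension at most the larger of [n] and [k],
   which bounds the length of its [omega]-resolution. *)
apply: wn; apply/resdim_finite; exists (maxn k n).
apply: cot_right_has_resolution => //; apply: orth_dim_all.
by apply: (orth_dim_mid ep); [apply: all_le Mk | apply: all_le Qn];
  rewrite (leq_maxl, leq_maxr).
Qed.

End Cotorsion.

Theorem theorem4p5 (R : pzRingType) (noethR : right_noetherian R)
    (findimR : (findim R < +oo)%E) :
  let A : mod_class R := cot_left small_finite_pd in
  let omega : mod_class R := cot_kernel small_finite_pd in
  (Findim R - findim R <= resdim_class A finite_pd)%E /\
  (Findim R = findim R <-> pd_class (wedge omega) = pd_class omega).
Proof.
move=> A omega; have [n [findimE Sn _]] := findim_nat noethR findimR.
split.
  rewrite findimE leeBlDr //; apply: ge_ereal_sup => _ [M PM ->].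
  apply: le_trans (finite_pd_resdim noethR M Sn) _.
  by apply: leeD2r; apply: ereal_sup_ubound; exists M.
rewrite (pd_class_omega noethR findimR); split=> [FE|wE].
  (* The dimension of [wedge omega] is squeezed between that of [omega], equal to [findim], and
     [Findim]. *)
  apply/eqP; rewrite eq_le -{1}FE pd_class_sub /=; last exact: wedge_omega_finite_pd.
  rewrite -(pd_class_omega noethR findimR); apply: pd_class_sub => M oM.
  by apply/resdim_finite; exists 0%N; exact: has_resolution0.
apply/eqP; rewrite eq_le; apply/andP; split; last by apply: pd_class_sub => M [].
rewrite findimE; apply/(pd_class_le noethR)/finite_pd_le_wedge_omega => //.
by apply/(pd_class_le noethR); rewrite wE findimE.
Qed.
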